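(* Let $p$ be a prime number, let $K=\mathbb{Q}[\sqrt{p}]$, and for every positive integer $n$ let $R_n$ denote the index $n$ order in $K$. The order $R_n$ is locally associated if any of the following conditions holds: (1) $n=2$ and $p\not\equiv 5 \pmod 8$; (2) $n=4$ and $p\equiv 1\pmod 8$; (3) $n=3$ and $p\not\equiv 3\pmod 4$. Moreover: (4) $R_{p^k}$ is locally associated for every integer $k\geq 1$ if and only if $R_p$ is locally associated. (5) If $p\equiv 5\pmod 8$, then $R_4$ is locally associated if and only if $R_2$ is locally associated. (6) If $q$ is an odd prime with $q\neq p$, then $R_{q^k}$ is locally associated for every integer $k\geq 1$ if and only if $R_{q^2}$ is locally associated. The order $R_n$ is NOT locally associated if any of the following conditions holds: (7) $n=q^k$ for some integer $k\ge 1$ and some odd prime $q\neq p$, and either $p\equiv 3\pmod 4$ or $q\equiv 1\pmod 4$; (8) $n=4$ and $p\equiv 3\pmod 4$; (9) $n=8$ and $p$ is odd.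
   Context: For a squarefree integer $d>1$ and $K=\mathbb{Q}[\sqrt d]$, the ring of algebraic integers of $K$ is $\overline{R}=\mathbb{Z}[\alpha]$, where $\alpha=\frac{1+\sqrt d}{2}$ if $d\equiv 1\pmod 4$ and $\alpha=\sqrt d$ otherwise. For a positive integer $n$, the index $n$ order in $K$ is $R_n=\mathbb{Z}[n\alpha]=\{a+nb\alpha : a,b\in\mathbb{Z}\}$. For a ring $S$, $U(S)$ denotes its group of units. The conductor ideal of an order $R$ in $K$ is $I=\{x\in R : x\overline{R}\subseteq R\}$; it is an ideal of both $R$ and $\overline{R}$. The order $R$ is called locally associated if $U(\overline{R})/U(R)\cong U(\overline{R}/I)/U(R/I)$ as groups. *)

(* Defs.v *)
From HB Require Import structures.
From mathcomp Require Import all_boot all_order all_fingroup all_algebra all_field.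
From mathcomp Require Import ring_quotient generic_quotient.
From mathcomp Require Import boolp ring.

Set Implicit Arguments.
Unset Strict Implicit.
Unset Printing Implicit Defensive.

Import Order.TTheory GRing.Theory Num.Theory.
Local Open Scope ring_scope.
Local Open Scope quotient_scope.

(** A unit is represented together with its inverse, so that equality and
    membership remain decidable over an arbitrary commutative ring. *)
Record unit_group (A : comPzRingType) := UnitGroup {
  unit_pair : A * A;
  _ : unit_pair.1 * unit_pair.2 == 1
}.

HB.instance Definition _ (A : comPzRingType) := [isSub for @unit_pair A].
HB.instance Definition _ (A : comPzRingType) := [Choice of unit_group A by <:].

Section UnitGroup.
Variable A : comPzRingType.
Implicit Types u v w : unit_group A.

Fact unit_one_subproof : ((1, 1) : A * A).1 * ((1, 1) : A * A).2 == 1.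
Proof. by rewrite /= mulr1. Qed.

Fact unit_inv_subproof u : ((val u).2, (val u).1).1 * ((val u).2, (val u).1).2 == 1.
Proof. by rewrite /= mulrC (valP u). Qed.

Fact unit_mul_subproof u v (w := ((val u).1 * (val v).1, (val u).2 * (val v).2)) :
  w.1 * w.2 == 1.
Proof. by rewrite /= mulrACA (eqP (valP u)) (eqP (valP v)) mulr1. Qed.

Definition unit_one : unit_group A := UnitGroup unit_one_subproof.
Definition unit_inv u : unit_group A := UnitGroup (unit_inv_subproof u).
Definition unit_mul u v : unit_group A := UnitGroup (unit_mul_subproof u v).

Fact unit_mulA : associative unit_mul.
Proof. by move=> u v w; apply/val_inj; rewrite /= !mulrA. Qed.

Fact unit_mulC : commutative unit_mul.
Proof.
by move=> u v; apply/val_inj; congr (_, _); apply: mulrC.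
Qed.

Fact unit_mul1 : left_id unit_one unit_mul.
Proof. by move=> u; apply/val_inj; rewrite /= !mul1r -surjective_pairing. Qed.

Fact unit_1mul : right_id unit_one unit_mul.
Proof. by move=> u; rewrite unit_mulC unit_mul1. Qed.

Fact unit_mulV : left_inverse unit_one unit_inv unit_mul.
Proof.
move=> u; apply/val_inj; rewrite /= (eqP (valP u)) mulrC.
by rewrite (eqP (valP u)).
Qed.

Fact unit_Vmul : right_inverse unit_one unit_inv unit_mul.
Proof. by move=> u; rewrite unit_mulC unit_mulV. Qed.

HB.instance Definition _ := isGroup.Build (unit_group A)
  unit_mulA unit_mul1 unit_1mul unit_mulV unit_Vmul.

Lemma unit_groupC u v : (u * v = v * u)%g.
Proof. exact: unit_mulC. Qed.

End UnitGroup.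

(** [units_in B] is U(B), seen as a subgroup of U(A) for a subring B of A. *)
Definition units_in (A : comPzRingType) (B : {pred A}) : {pred unit_group A} :=
  fun u => ((val u).1 \in B) && ((val u).2 \in B).

Section UnitQuotient.
Variables (A : comPzRingType) (B : subringClosed A).
Implicit Types u v w : unit_group A.

Fact units_in_group_closed : group_closed (units_in B).
Proof.
split=> [|u v /andP[u1 u2] /andP[v1 v2]]; apply/andP; first by rewrite /= rpred1.
by rewrite /= !rpredM.
Qed.

Definition unit_eqv u v := (u * v^-1)%g \in units_in B.

Fact unit_eqv_equiv : equiv_class_of unit_eqv.
Proof.
have [U1 UV] := units_in_group_closed.
have UM := group_closedM (conj U1 UV); have UI := group_closedV (conj U1 UV).
have invE u v : ((u * v^-1)^-1 = v * u^-1)%g by rewrite invgM invgK.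
split=> [u|u v|v u w]; rewrite /unit_eqv ?mulgV //.
  by apply/idP/idP => /UI; rewrite invE.
by move=> uv vw; have := UM _ _ uv vw; rewrite mulgA mulgVK.
Qed.

Canonical unit_eqv_rel := EquivRelPack unit_eqv_equiv.
Canonical unit_eqv_encModRel := defaultEncModRel unit_eqv.

(** The quotient group U(A) / U(B). *)
Definition unit_quot := {eq_quot unit_eqv}.

HB.instance Definition _ := EqQuotient.on unit_quot.
HB.instance Definition _ := Choice.on unit_quot.

Definition unit_quot_one : unit_quot := lift_cst unit_quot 1%g.
Definition unit_quot_inv := lift_op1 unit_quot (fun u => u^-1)%g.
Definition unit_quot_mul := lift_op2 unit_quot (fun u v => u * v)%g.

Canonical unit_quot_one_morph := PiConst unit_quot_one.

Fact unit_quotE u v : (u == v %[mod unit_quot]) = ((u * v^-1)%g \in units_in B).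
Proof. by rewrite piE. Qed.

Fact pi_unit_inv : {morph \pi : u / (u^-1)%g >-> unit_quot_inv u}.
Proof.
move=> u; unlock unit_quot_inv; apply/eqP; rewrite unit_quotE.
rewrite invgK unit_groupC -unit_quotE; apply/eqP.
by rewrite reprK.
Qed.
Canonical unit_quot_inv_morph := PiMorph1 pi_unit_inv.

Fact pi_unit_mul : {morph \pi : u v / (u * v)%g >-> unit_quot_mul u v}.
Proof.
move=> u v; unlock unit_quot_mul; apply/eqP; rewrite unit_quotE.
have rel w : (w * (repr (\pi_unit_quot w))^-1)%g \in units_in B.
  by rewrite -unit_quotE reprK.
have [U1 UV] := units_in_group_closed.
have := group_closedM (conj U1 UV) (rel u) (rel v).
set u' := repr _; set v' := repr _.
suff -> : (u * u'^-1 * (v * v'^-1) = u * v * (u' * v')^-1)%g by [].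
rewrite invgM [(v'^-1 * _)%g]unit_groupC !mulgA; congr (_ * _)%g.
by rewrite -!mulgA; congr (_ * _)%g; apply: unit_groupC.
Qed.
Canonical unit_quot_mul_morph := PiMorph2 pi_unit_mul.

Fact unit_quot_mulA : associative unit_quot_mul.
Proof. by move=> u v w; rewrite -[u]reprK -[v]reprK -[w]reprK !piE mulgA. Qed.

Fact unit_quot_mul1 : left_id unit_quot_one unit_quot_mul.
Proof. by move=> u; rewrite -[u]reprK !piE mul1g. Qed.

Fact unit_quot_1mul : right_id unit_quot_one unit_quot_mul.
Proof. by move=> u; rewrite -[u]reprK !piE mulg1. Qed.

Fact unit_quot_mulV : left_inverse unit_quot_one unit_quot_inv unit_quot_mul.
Proof. by move=> u; rewrite -[u]reprK !piE mulVg. Qed.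

Fact unit_quot_Vmul : right_inverse unit_quot_one unit_quot_inv unit_quot_mul.
Proof. by move=> u; rewrite -[u]reprK !piE mulgV. Qed.

HB.instance Definition _ := isGroup.Build unit_quot
  unit_quot_mulA unit_quot_mul1 unit_quot_1mul unit_quot_mulV unit_quot_Vmul.

End UnitQuotient.

Definition conductor (A : comPzRingType) (B : {pred A}) : {pred A} :=
  fun x => (x \in B) && `[< forall y : A, x * y \in B >].

Section ConductorQuotient.
Variables (A : comPzRingType) (B : subringClosed A).

Fact conductorP x :
  reflect (x \in B /\ forall y, x * y \in B) (x \in conductor B).
Proof. by apply: (iffP andP) => -[xB /asboolP]. Qed.

Fact conductor_zmod_closed : zmod_closed (conductor B).
Proof.
split=> [|x y /conductorP[xB xI] /conductorP[yB yI]]; apply/conductorP.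
  by split=> [|y]; rewrite ?mul0r rpred0.
by split=> [|z]; rewrite ?mulrBl rpredB.
Qed.

HB.instance Definition _ :=
  GRing.isZmodClosed.Build A (conductor B) conductor_zmod_closed.

Fact conductorMl x y : x \in conductor B -> x * y \in conductor B.
Proof.
move=> /conductorP[xB xI]; apply/conductorP.
by split=> [|z]; rewrite -?mulrA.
Qed.

(** The ring A / I for I the conductor of B. The library's [{ideal_quot _}]
    requires a proper ideal; here I may be all of A (when B is). *)
Definition cond_quot := {ideal_quot conductor B}.

HB.instance Definition _ := GRing.Zmodule.on cond_quot.
HB.instance Definition _ := EqQuotient.on cond_quot.

Definition cond_quot_one : cond_quot := lift_cst cond_quot 1.
Definition cond_quot_mul := lift_op2 cond_quot *%R.

Canonical cond_quot_one_morph := PiConst cond_quot_one.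

Fact pi_cond_mul : {morph \pi : x y / x * y >-> cond_quot_mul x y}.
Proof.
move=> x y; unlock cond_quot_mul; apply/eqP.
rewrite -Quotient.idealrBE -[x * y](addrNK (x * repr (\pi_cond_quot y))) -mulrBr.
rewrite -addrA -mulrBl rpredD //; last first.
  by rewrite conductorMl // Quotient.idealrBE reprK.
by rewrite mulrC conductorMl // Quotient.idealrBE reprK.
Qed.
Canonical cond_quot_mul_morph := PiMorph2 pi_cond_mul.

Fact cond_quot_mulA : associative cond_quot_mul.
Proof. by move=> x y z; rewrite -[x]reprK -[y]reprK -[z]reprK !piE mulrA. Qed.

Fact cond_quot_mulC : commutative cond_quot_mul.
Proof. by move=> x y; rewrite -[x]reprK -[y]reprK !piE mulrC. Qed.

Fact cond_quot_mul1 : left_id cond_quot_one cond_quot_mul.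
Proof. by move=> x; rewrite -[x]reprK !piE mul1r. Qed.

Fact pi_cond_add (x y : A) :
  \pi_cond_quot (x + y) = \pi_cond_quot x + \pi_cond_quot y.
Proof. exact: Quotient.pi_add. Qed.

Fact cond_quot_mulDl : left_distributive cond_quot_mul +%R.
Proof.
move=> x y z; rewrite -[x]reprK -[y]reprK -[z]reprK.
by rewrite -pi_cond_add -!pi_cond_mul mulrDl pi_cond_add.
Qed.

HB.instance Definition _ := GRing.Zmodule_isComPzRing.Build cond_quot
  cond_quot_mulA cond_quot_mulC cond_quot_mul1 cond_quot_mulDl.

(** The ring B / I, as a subring of A / I. *)
Definition cond_subquot : {pred cond_quot} :=
  fun z => `[< exists2 x, x \in B & z = \pi_cond_quot x >].

Fact cond_subquot_subring_closed : subring_closed cond_subquot.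
Proof.
split=> [|z t|z t].
- apply/asboolP; exists 1; first exact: rpred1.
  by rewrite -[LHS]/cond_quot_one piE.
- move=> /asboolP[x xB ->] /asboolP[y yB ->]; apply/asboolP.
  exists (x - y); first exact: rpredB.
  by rewrite pi_cond_add; congr (_ + _); apply/esym/Quotient.pi_opp.
- move=> /asboolP[x xB ->] /asboolP[y yB ->]; apply/asboolP.
  by exists (x * y); [exact: rpredM | rewrite pi_cond_mul].
Qed.

HB.instance Definition _ :=
  GRing.isSubringClosed.Build cond_quot cond_subquot cond_subquot_subring_closed.

End ConductorQuotient.

Arguments cond_subquot {A} B _.

Definition locally_associated (A : comPzRingType) (B : subringClosed A) : Prop :=
  exists f : {multiplicative unit_quot B -> unit_quot (cond_subquot B)},
    bijective f.

(** The field Q[sqrt d], inside the algebraic complex numbers. *)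
Definition sqrt_field (d : nat) : {pred algC} := Crat_span [:: 1; sqrtC d%:R].

Fact sqrt_fieldP d x :
  reflect (exists a b : rat, x = ratr a + ratr b * sqrtC d%:R)
          (x \in sqrt_field d).
Proof.
apply: (iffP (Crat_spanP _ _)) => [[a ->]|[a [b ->]]].
  by exists (a ord0), (a (lift ord0 ord0)); rewrite !big_ord_recl big_ord0 /= mulr1 addr0.
exists [ffun i => if i == ord0 then a else b].
by rewrite !big_ord_recl big_ord0 !ffunE /= mulr1 addr0.
Qed.

Definition sqrt_int (d : nat) : {pred algC} := [predI Aint & sqrt_field d].

Fact sqrt_int_subring_closed d : subring_closed (sqrt_int d).
Proof.
have sqr : sqrtC d%:R * sqrtC d%:R = ratr d%:R :> algC.
  by rewrite -expr2 sqrtCK ratr_nat.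
split=> [|x y /andP[xA xK] /andP[yA yK]|x y /andP[xA xK] /andP[yA yK]].
- apply/andP; split; first exact: Aint1.
  by apply: mem_Crat_span; rewrite inE eqxx.
- by apply/andP; split; apply: rpredB.
- apply/andP; split; first exact: rpredM.
  case/sqrt_fieldP: xK => a [b ->]; case/sqrt_fieldP: yK => a' [b' ->].
  apply/sqrt_fieldP; exists (a * a' + b * b' * d%:R), (a * b' + b * a').
  rewrite !rmorphD !rmorphM /= -sqr; ring.
Qed.

HB.instance Definition _ d :=
  GRing.isSubringClosed.Build algC (sqrt_int d) (sqrt_int_subring_closed d).

(** The ring of algebraic integers of Q[sqrt d]. *)
Definition int_ring (d : nat) := {x : algC | x \in sqrt_int d}.

HB.instance Definition _ d := [isSub of int_ring d for @sval _ _].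
HB.instance Definition _ d := [Choice of int_ring d by <:].
HB.instance Definition _ d := [SubChoice_isSubComNzRing of int_ring d by <:].

Definition alpha (d : nat) : algC :=
  if (d == 1 %[mod 4])%N then (1 + sqrtC d%:R) / 2%:R else sqrtC d%:R.

(** The order Z[n alpha] = Z + Z n alpha, as a subring of [int_ring d]. *)
Definition quad_order (d n : nat) : {pred int_ring d} :=
  fun x => val x \in Cint_span [:: 1; n%:R * alpha d].

Fact Cint_span2P y x :
  reflect (exists a b : int, x = a%:~R + b%:~R * y) (x \in Cint_span [:: 1; y]).
Proof.
apply: (iffP (Cint_spanP [tuple 1; y] _)) => [[a ->]|[a [b ->]]].
  exists (a ord0), (a (lift ord0 ord0)).
  by rewrite !big_ord_recl big_ord0 /= mulrzl addr0.
exists [ffun i => if i == ord0 then a else b].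
by rewrite !big_ord_recl big_ord0 !ffunE /= mulrzl addr0.
Qed.

Fact alpha_sqr d : exists t m : nat, alpha d ^+ 2 = t%:R * alpha d + m%:R.
Proof.
rewrite /alpha; case: eqP => [d1|_]; last first.
  by exists 0, d; rewrite sqrtCK mul0r add0r.
exists 1, (d %/ 4)%N; have := sqrtCK (d%:R : algC).
have dE : d%:R = (d %/ 4)%:R * 4%:R + 1 :> algC.
  by rewrite {1}(divn_eq d 4) d1 natrD natrM.
rewrite {2}dE; move: (sqrtC _) => s sE.
have -> : ((1 + s) / 2%:R) ^+ 2 = (1 + 2%:R * s + s ^+ 2) / 4%:R by field.
by rewrite sE; field.
Qed.

Fact quad_order_subring_closed d n : subring_closed (@quad_order d n).
Proof.
split=> [|x y xR yR|x y /Cint_span2P[a [b xE]] /Cint_span2P[a' [b' yE]]].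
- by apply: mem_Cint_span; rewrite inE eqxx.
- exact: (rpredB xR yR).
- have [t [m aE]] := alpha_sqr d; apply/Cint_span2P.
  exists (a * a' + b * b' * (n%:R ^+ 2 * m%:R)),
         (a * b' + b * a' + b * b' * (n%:R * t%:R)).
  rewrite [val (x * y)]rmorphM /= xE yE !rmorphD !rmorphM /= !rmorph_nat.
  move: aE; move: (alpha d) => z zE.
  transitivity (a%:~R * a'%:~R + (a%:~R * b'%:~R + b%:~R * a'%:~R) * (n%:R * z)
                + b%:~R * b'%:~R * n%:R ^+ 2 * z ^+ 2); first ring.
  rewrite zE; ring.
Qed.

HB.instance Definition _ d n :=
  GRing.isSubringClosed.Build (int_ring d) (@quad_order d n)
    (quad_order_subring_closed d n).

Arguments quad_order d n _ : clear implicits.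

(* Main.v *)
(** Write O for the maximal order, with conductor nO in the order of index n. The
    natural map from U(O)/U(R_n) to U(O/nO)/U(R_n/nO) is injective and its target
    is finite, so an abstract isomorphism exists exactly when the natural map is
    onto: every element prime to n is, modulo n, an integer times a unit of O.

    Surjectivity at n is lifted to nq by a unit of R_n lying outside R_nq, and the
    q-th power of such a unit serves for nq in turn. The units needed to start come
    from Pell's equation, solved by walking along Conway's river, and from descent
    on its least solution: norm -1 for p = 1 mod 4, and an odd coefficient of
    sqrt p for p = 3 mod 4. The negative results are norm obstructions: if the map
    is onto, every norm prime to n is plus or minus a square modulo n, and simply a
    square when no unit has norm -1. *)

From HB Require Import structures.
Require Import Defs.
From mathcomp Require Import all_boot all_order all_fingroup all_algebra all_field.
From mathcomp Require Import ring_quotient generic_quotient boolp.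
From mathcomp Require Import ring zify.

Set Implicit Arguments.
Unset Strict Implicit.
Unset Printing Implicit Defensive.

Import Order.TTheory GRing.Theory Num.Theory.
Local Open Scope ring_scope.

(** * The natural map of unit quotients *)

Section NaturalMap.
Local Open Scope quotient_scope.
Variables (A : comPzRingType) (B : subringClosed A).
Implicit Types (u v : unit_group A) (z : unit_quot B).

Fact pi_cond1 : \pi_(cond_quot B) 1 = 1.
Proof. by rewrite -[RHS]/(cond_quot_one B) piE. Qed.

Fact pi_condM (x y : A) :
  \pi_(cond_quot B) (x * y) = \pi_(cond_quot B) x * \pi_(cond_quot B) y.
Proof. exact: pi_cond_mul. Qed.

Lemma pi_condP (x y : A) :
  reflect (\pi_(cond_quot B) x = \pi_(cond_quot B) y) (x - y \in conductor B).
Proof. by rewrite Quotient.idealrBE; apply: eqP. Qed.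

Fact unit_red_subproof u :
  (\pi_(cond_quot B) (val u).1, \pi_(cond_quot B) (val u).2).1 *
  (\pi_(cond_quot B) (val u).1, \pi_(cond_quot B) (val u).2).2 == 1.
Proof. by rewrite /= -pi_condM (eqP (valP u)) pi_cond1. Qed.

Definition unit_red u : unit_group (cond_quot B) := UnitGroup (unit_red_subproof u).

Lemma unit_redM u v : unit_red (u * v)%g = (unit_red u * unit_red v)%g.
Proof. by apply/val_inj; rewrite /= !pi_condM. Qed.

Lemma unit_redV u : unit_red u^-1%g = (unit_red u)^-1%g.
Proof. exact/val_inj. Qed.

(** The conductor lies in [B], so membership in [B] depends only on the class modulo the conductor.
    Hence the natural map is well defined and injective. *)
Lemma cond_subquotP (x : A) :
  reflect (x \in B) (\pi_(cond_quot B) x \in cond_subquot B).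
Proof.
apply: (iffP (asboolP _)) => [[y yB /pi_condP /conductorP[xyB _]]|xB]; last by exists x.
by rewrite -[x](subrK y) rpredD.
Qed.

Lemma units_in_red u : (unit_red u \in units_in (cond_subquot B)) = (u \in units_in B).
Proof.
by apply/andP/andP => -[] /= h1 h2; split; apply/cond_subquotP.
Qed.

Definition natural_map z : unit_quot (cond_subquot B) :=
  \pi_(unit_quot (cond_subquot B)) (unit_red (repr z)).

Lemma natural_mapE u :
  natural_map (\pi_(unit_quot B) u) = \pi_(unit_quot (cond_subquot B)) (unit_red u).
Proof.
apply/eqP; rewrite unit_quotE -unit_redV -unit_redM units_in_red -unit_quotE.
by rewrite reprK.
Qed.

Lemma natural_mapM : {morph natural_map : z t / (z * t)%g}.
Proof.
move=> z t; rewrite -[z]reprK -[t]reprK.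
transitivity (natural_map (\pi_(unit_quot B) (repr z * repr t)%g)).
  by congr natural_map; exact/esym/pi_unit_mul.
by rewrite !natural_mapE unit_redM; exact: pi_unit_mul.
Qed.

Lemma natural_map_inj : injective natural_map.
Proof.
move=> z t; rewrite -[z]reprK -[t]reprK !natural_mapE => /eqP.
by rewrite unit_quotE -unit_redV -unit_redM units_in_red -unit_quotE => /eqP.
Qed.

HB.instance Definition _ := isMultiplicative.Build _ _ natural_map natural_mapM.

Lemma locally_associated_surj :
  (forall w, exists z, natural_map z = w) -> locally_associated B.
Proof.
move=> surj; pose g w := sval (cid (surj w)).
have gK : cancel g natural_map by move=> w; exact: svalP (cid (surj w)).
by exists natural_map; exists g => // z; apply: natural_map_inj; rewrite gK.
Qed.

(* An injective map of a finite set into itself is onto; apply this to the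
   natural map composed with the inverse of an arbitrary isomorphism. *)
Lemma locally_associated_finite_surj (s : seq (cond_quot B)) :
  (forall x, x \in s) -> locally_associated B ->
  forall w, exists z, natural_map z = w.
Proof.
move=> sE [f [g fK gK]] w.
pose us : seq (unit_group (cond_quot B)) := pmap insub (allpairs pair s s).
pose l := undup [seq \pi_(unit_quot (cond_subquot B)) x | x <- us].
have lE t : t \in l.
  rewrite mem_undup; apply/mapP; exists (repr t); last by rewrite reprK.
  rewrite mem_pmap_sub; apply/allpairsP; exists (val (repr t)).
  by rewrite !sE -surjective_pairing.
have injh : injective (natural_map \o g).
  by apply: inj_comp; [exact: natural_map_inj | exact: can_inj gK].
pose l' := map (natural_map \o g) l.
have ul' : uniq l' by rewrite map_inj_uniq // undup_uniq.
have sl' : {subset l' <= l} by move=> t _; exact: lE.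
have szl' : (size l <= size l')%N by rewrite size_map.
have [_ l'E] := uniq_min_size ul' sl' szl'.
have : w \in l' by rewrite l'E.
by case/mapP => t _ ->; exists (g t).
Qed.

End NaturalMap.

(** * Conway's river and Pell's equation *)

Lemma pigeonhole_seq (T : eqType) (s : seq T) (g : nat -> T) :
  (forall i, g i \in s) -> exists i j, (i < j)%N /\ g i = g j.
Proof.
move=> gs; pose l := [seq g i | i <- iota 0 (size s).+1].
have : ~~ uniq l.
  apply/negP => ul; have sl : {subset l <= s} by move=> _ /mapP[i _ ->].
  by have := uniq_leq_size ul sl; rewrite size_map size_iota ltnn.
case/(uniqPn (g 0)) => i [j [ij]]; rewrite size_map size_iota => jl.
have il := ltn_trans ij jl.
by rewrite !(nth_map 0) ?size_iota // !nth_iota // !add0n => e; exists i, j.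
Qed.

Section River.
Variable p : int.

(* Conway's river of [x^2 - p y^2]: [(a, b, c)] stands for the form
   [a X^2 + 2 b X Y + c Y^2], and one step replaces a basis vector by the sum of
   both, keeping the values at the two basis vectors of opposite signs. *)
Definition river_step (f : int * int * int) :=
  let: (a, b, c) := f in
  if 0 < a + 2 * b + c then (a + 2 * b + c, b + c, c)
  else (a, a + b, a + 2 * b + c).

Definition on_river (f : int * int * int) :=
  let: (a, b, c) := f in [&& b ^+ 2 - a * c == p, 0 < a & c < 0].

Hypothesis p_nonsquare : forall x y : int, x ^+ 2 = p * y ^+ 2 -> y = 0.

Lemma river_value_neq0 a b c : on_river (a, b, c) -> a + 2 * b + c != 0.
Proof.
case/and3P => /eqP e a0 c0; apply/eqP => z.
(* Substituting [c = - a - 2 b] turns [b ^+ 2 - a * c] into a square, yet it equals [p]. *)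
have /p_nonsquare : (a + b) ^+ 2 = p * 1 ^+ 2 by nia.
by [].
Qed.

Lemma on_river_step f : on_river f -> on_river (river_step f).
Proof.
case: f => [[a b] c] h; have := river_value_neq0 h; case/and3P: h => /eqP e a0 c0 nz.
rewrite /river_step; case: ifP => h; apply/and3P; split; try (apply/eqP); nia.
Qed.

(** In the new form, [a - 2 * b + c] is the coefficient that was replaced; its sign tells which
    branch was taken. *)
Lemma river_step_inj f g :
  on_river f -> on_river g -> river_step f = river_step g -> f = g.
Proof.
case: f g => [[a b] c] [[a' b'] c'] /and3P[_ a0 c0] /and3P[_ a0' c0'] /=.
by case: ifP => _; case: ifP => _ [e1 e2 e3]; repeat congr (_, _); lia.
Qed.

Let range : seq int := [seq i%:Z - p | i <- iota 0 ((absz p).*2).+1].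

(** From [b ^+ 2 + a * |c| = p] with [a] and [|c|] at least 1, only finitely many forms lie on the
    river. *)
Lemma on_river_bounded f :
  on_river f -> f \in allpairs pair (allpairs pair range range) range.
Proof.
case: f => [[a b] c] /and3P[/eqP e a0 c0].
have rP (x : int) : - p <= x <= p -> x \in range.
  move=> h; apply/mapP; exists (absz (x + p)); rewrite ?mem_iota; lia.
have ac : a * c <= - a by nia.
have ca : a * c <= c by nia.
have b2 : b <= b ^+ 2 /\ - b <= b ^+ 2 by split; nia.
have b0 : 0 <= b ^+ 2 by nia.
apply/allpairsP; exists ((a, b), c); split=> //; last by apply: rP => /=; lia.
by apply/allpairsP; exists (a, b); split=> //; apply: rP => /=; lia.
Qed.

Lemma river_periodic f : on_river f -> exists2 k, (0 < k)%N & iter k river_step f = f.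
Proof.
move=> fr; have it k : on_river (iter k river_step f).
  by elim: k => // k; exact: on_river_step.
have [i [j [ij e]]] := pigeonhole_seq (fun k => on_river_bounded (it k)).
exists (j - i)%N; first lia.
(* Injectivity moves the repetition back to the start of the walk. *)
elim: i j ij e => [|i IH] [|j] // ij.
by rewrite subSS => /(river_step_inj (it i) (it j)); exact: IH.
Qed.

Lemma pell_solution : 0 < p -> exists x y : int, x ^+ 2 - p * y ^+ 2 = 1 /\ y != 0.
Proof.
move=> p0; have fr : on_river (1, 0, - p) by apply/and3P; split; lia.
have [k k0 kE] := river_periodic fr.
(* After [k] steps the form is the original one in a basis of determinant 1 with nonnegative
   entries, whose sum grows at each step. *)
have : exists x1 y1 x2 y2 : int,
  [/\ iter k river_step (1, 0, - p) =
      (x1 ^+ 2 - p * y1 ^+ 2, x1 * x2 - p * y1 * y2, x2 ^+ 2 - p * y2 ^+ 2),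
      x1 * y2 - x2 * y1 = 1,
      [&& 0 <= x1, 0 <= y1, 0 <= x2 & 0 <= y2] &
      k%:Z + 2 <= x1 + y1 + x2 + y2].
  elim: k {k0 kE} => [|k [x1 [y1 [x2 [y2 [e d]]]]]].
    exists 1, 0, 0, 1; split => //=; congr (_, _, _); lia.
  case/and4P => h1 h2 h3 h4 hk; rewrite iterS e /=; case: ifP => _.
    exists (x1 + x2), (y1 + y2), x2, y2.
    by split; [congr (_, _, _); ring | nia | apply/and4P; split; nia | nia].
  exists x1, y1, (x1 + x2), (y1 + y2).
  by split; [congr (_, _, _); ring | nia | apply/and4P; split; nia | nia].
case=> x1 [y1 [x2 [y2 []]]]; rewrite kE => -[e1 e2 e3] d /and4P[h1 h2 h3 h4] hk.
exists x1, y1; split; first by [].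
(* If [y1 = 0], the basis is the initial one, with entry sum 2, although [k > 0]. *)
apply/eqP => z; rewrite z in e1 e2 d hk.
have x11 : x1 = 1 by nia.
have x20 : x2 = 0 by rewrite x11 in e2; lia.
rewrite x11 in d hk; lia.
Qed.

End River.

(** * Descent on Pell's equation *)

Lemma coprime_mul_sqr (a b z : nat) :
  coprime a b -> (a * b = z ^ 2)%N -> exists c, (a = c ^ 2)%N.
Proof.
move=> ab e; have [a0|a0] := posnP a; first by exists 0%N; rewrite a0.
(* Writing [a = a' d] and [z = z' d] gives [a' b = d z' ^ 2]; by coprimality [a'] and [d] divide
   each other. *)
pose d := gcdn a z; have d0 : (0 < d)%N by rewrite gcdn_gt0 a0.
have /dvdnP[a' aE] := dvdn_gcdl a z; have /dvdnP[z' zE] := dvdn_gcdr a z.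
rewrite -/d in aE zE; exists d; rewrite {1}aE expnS expn1; congr (_ * d)%N.
have cop : coprime a' z'.
  by rewrite /coprime -(eqn_pmul2r d0) muln_gcdl -aE -zE mul1n.
have e' : (a' * b = d * z' ^ 2)%N.
  apply/eqP; rewrite -(eqn_pmul2r d0); apply/eqP; move: e; rewrite {1}aE {1}zE; lia.
apply/eqP; rewrite eqn_dvd; apply/andP; split.
  rewrite -(@Gauss_dvdl a' d (z' ^ 2)) ?coprimeXr // -e'; exact: dvdn_mulr.
have db : coprime d b by apply: coprime_dvdl ab; exact: dvdn_gcdl.
by rewrite -(Gauss_dvdl _ db) e' dvdn_mulr.
Qed.

(** Otherwise the exponent of [p] would be even on the left and odd on the right. *)
Lemma prime_nonsquare (p : nat) (x y : int) :
  prime p -> x ^+ 2 = p%:Z * y ^+ 2 -> y = 0.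
Proof.
move=> pp e; have [//|y0] := eqVneq y 0.
have e' : (`|x| ^ 2 = p * `|y| ^ 2)%N by lia.
have y0' : (0 < `|y|)%N by lia.
have := congr1 (fun n => odd (logn p n)) e'.
rewrite lognM ?expn_gt0 ?y0' ?prime_gt0 // (logn_prime _ pp) eqxx !lognX; lia.
Qed.

(* Infinite descent on the least solution: if y is even, (x - 1)/2 and (x + 1)/2
   are coprime with product p (y/2)^2, so one is a square and the other is p
   times a square. *)
Lemma pell_descent (p : nat) : prime p -> odd p ->
  exists x y : nat, (x ^ 2 + 1 = p * y ^ 2)%N \/ odd y /\ (x ^ 2 = p * y ^ 2 + 1)%N.
Proof.
move=> pp op; have p0 := prime_gt0 pp.
have [X [Y [e Y0]]] : exists X Y : int, X ^+ 2 - p%:Z * Y ^+ 2 = 1 /\ Y != 0.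
  by apply: pell_solution => [x y|]; [exact: prime_nonsquare | lia].
have exy : exists y, (0 < y)%N && `[< exists x, (x ^ 2 = p * y ^ 2 + 1)%N >].
  exists `|Y|%N; apply/andP; split; first lia.
  by apply/asboolP; exists `|X|%N; lia.
have [y /andP[y0 /asboolP[x xE]] ymin] := ex_minnP exy.
have [oy|ey] := boolP (odd y); first by exists x, y; right.
have ox : odd x by have := congr1 odd xE; rewrite oddX oddD oddM oddX (negbTE ey) andbF.
pose z := y./2; pose r := x./2.
have zE : y = z.*2 by rewrite -[LHS]odd_double_half (negbTE ey).
have rE : x = r.*2.+1 by rewrite -[LHS]odd_double_half ox.
have rz : (r * r.+1 = p * z ^ 2)%N by move: xE; rewrite zE rE; nia.
have cop : coprime r r.+1 by rewrite coprimenS.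
have : (p %| r * r.+1)%N by rewrite rz dvdn_mulr.
rewrite Euclid_dvdM // => /orP[] /dvdnP[s sE].
  (* If [p] divides [r], then [r.+1 = a ^ 2] and [r = p * b ^ 2], so [b] is a solution smaller than
     [y = 2 * a * b]. *)
  have e1 : (s * r.+1 = z ^ 2)%N.
    by apply/eqP; rewrite -(eqn_pmul2l p0) -rz sE; apply/eqP; lia.
  have cs : coprime s r.+1 by apply: coprime_dvdl cop; rewrite sE dvdn_mulr.
  have [b bE] := coprime_mul_sqr cs e1.
  have [a aE] : exists a, (r.+1 = a ^ 2)%N.
    by apply: (@coprime_mul_sqr _ s z); [rewrite coprime_sym | rewrite mulnC].
  have b0 : (0 < b)%N by rewrite lt0n; apply/eqP => b0; rewrite bE b0 in e1; nia.
  have by' : (y <= b)%N.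
    apply: ymin; apply/andP; split=> //; apply/asboolP; exists a.
    by rewrite -aE sE bE; lia.
  have zE' : (z ^ 2 = (a * b) ^ 2)%N by rewrite -e1 aE bE expnMn mulnC.
  have {}zE' : z = (a * b)%N by apply/eqP; rewrite -(eqn_exp2r _ _ (isT : 0 < 2)%N) zE'.
  have a0 : (0 < a)%N by rewrite lt0n; apply/eqP => a0; rewrite a0 in aE.
  have bab := leq_pmull b a0.
  by move: by' b0 bab; rewrite zE zE' -muln2; clear; move: (a * b)%N => ab; lia.
(* If [p] divides [r.+1], then [r = a ^ 2] and [r.+1 = p * b ^ 2], which gives norm -1. *)
have e1 : (r * s = z ^ 2)%N.
  by apply/eqP; rewrite -(eqn_pmul2l p0) -rz sE; apply/eqP; lia.
have cs : coprime r s by apply: coprime_dvdr cop; rewrite sE dvdn_mulr.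
have [a aE] := coprime_mul_sqr cs e1.
have [b bE] : exists b, (s = b ^ 2)%N.
  by apply: (@coprime_mul_sqr _ r z); [rewrite coprime_sym | rewrite mulnC].
by exists a, b; left; rewrite -aE -bE; lia.
Qed.

Lemma negative_pell (p : nat) : prime p -> p = 1 %[mod 4] ->
  exists x y : int, x ^+ 2 - p%:Z * y ^+ 2 = -1.
Proof.
move=> pp p1; have op : odd p by lia.
have [x [y [e|[oy e]]]] := pell_descent pp op; first by exists x, y; lia.
(* For odd [y], [p * y ^ 2 + 1] is 2 modulo 4, hence not a square. *)
have [k yE] : exists k, y = k.*2.+1 by exists y./2; lia.
pose h := x./2; have xE : x = (odd x + h.*2)%N by rewrite odd_double_half.
by move: e; rewrite xE yE; case: (odd x); nia.
Qed.

(** Norm -1 is excluded modulo 4: [x ^ 2 + 1] is 1 or 2, while [p * y ^ 2] is 0 or 3. *)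
Lemma pell_odd (p : nat) : prime p -> p = 3 %[mod 4] ->
  exists x y : int, x ^+ 2 - p%:Z * (2 * y + 1) ^+ 2 = 1.
Proof.
move=> pp p3; have op : odd p by lia.
have [x [y [e|[oy e]]]] := pell_descent pp op.
  pose h := x./2; have xE : x = (odd x + h.*2)%N by rewrite odd_double_half.
  pose k := y./2; have yE : y = (odd y + k.*2)%N by rewrite odd_double_half.
  by move: e; rewrite xE yE; case: (odd x); case: (odd y); nia.
by exists x, (y./2)%:Z; rewrite (_ : 2 * _ + 1 = y%:Z); lia.
Qed.

(** * Units modulo n in coordinates *)

Lemma coprimez_prime (q : nat) (x : int) : prime q -> coprimez x q = ~~ (q %| x)%Z.
Proof. by move=> pq; rewrite coprimezE coprime_sym prime_coprime // dvdzE. Qed.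

Lemma dvdz_primeM (q : nat) (x y : int) :
  prime q -> (q %| x * y)%Z = (q %| x)%Z || (q %| y)%Z.
Proof. by move=> pq; rewrite !dvdzE abszM Euclid_dvdM. Qed.

Lemma dvdz_primeX (q : nat) (x : int) k : prime q -> (q %| x ^+ k)%Z -> (q %| x)%Z.
Proof. by move=> pq; rewrite !dvdzE abszX Euclid_dvdX // => /andP[]. Qed.

Lemma linear_congruence (q : nat) (x y : int) :
  prime q -> ~~ (q %| x)%Z -> exists j : nat, (q %| x * j%:Z + y)%Z.
Proof.
move=> pq; rewrite -coprimez_prime // => /coprimezP[[a b] /= e].
have q0 : (q%:Z : int) != 0 by have := prime_gt0 pq; lia.
exists (absz ((- (a * y)) %% q)%Z); rewrite gez0_abs ?modz_ge0 //.
have -> : ((- (a * y)) %% q)%Z = - (a * y) - (- (a * y) %/ q)%Z * q.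
  by rewrite [X in _ = X - _](divz_eq _ q%:Z); ring.
apply/dvdzP; exists (b * y - x * (- (a * y) %/ q)%Z).
move: (_ %/ _)%Z => d; have h : 1 - a * x = b * q by rewrite -e; ring.
have -> : x * (- (a * y) - d * q) + y = (1 - a * x) * y - x * d * q by ring.
by rewrite h; ring.
Qed.

Section QuadraticInt.
Variables t m : int.
Implicit Types (w z : int * int).

(* A pair [z] stands for [z.1 + z.2 al], where [al ^+ 2 = t * al + m]. *)
Definition qmul w z : int * int :=
  (w.1 * z.1 + m * w.2 * z.2, w.1 * z.2 + w.2 * z.1 + t * w.2 * z.2).

(** The product of [z] with its conjugate, where [al] has conjugate [t - al]. Units are expressed
    below by [qnorm w ^+ 2 = 1]. *)
Definition qnorm z : int := z.1 ^+ 2 + t * z.1 * z.2 - m * z.2 ^+ 2.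

Definition qpow w j : int * int := iter j (qmul w) (1, 0).

Lemma qmulA : associative qmul.
Proof. by move=> [a b] [c d] [e f]; rewrite /qmul /=; congr (_, _); ring. Qed.

Lemma qnormM w z : qnorm (qmul w z) = qnorm w * qnorm z.
Proof. by case: w z => [a b] [c d]; rewrite /qnorm /qmul /=; ring. Qed.

Lemma qpowS w j : qpow w j.+1 = qmul w (qpow w j).
Proof. by []. Qed.

Lemma qnormX w j : qnorm (qpow w j) = qnorm w ^+ j.
Proof. by elim: j => [|j IH]; rewrite ?qpowS ?qnormM ?IH ?exprS // /qnorm /=; ring. Qed.

(* Surjectivity of the natural map of unit quotients for the order of index [n]:
   each unit modulo [n] becomes an integer modulo [n] when multiplied by a unit. *)
Definition units_onto (n : int) : Prop :=
  forall z, coprimez (qnorm z) n ->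
    exists w, qnorm w ^+ 2 = 1 /\ (n %| (qmul z w).2)%Z.

(* A unit of the order of index [n] lying outside the order of index [n * q]. *)
Definition exact_unit (q : nat) (n : int) : Prop :=
  exists A B : int, qnorm (A, n * B) ^+ 2 = 1 /\ ~~ (q %| B)%Z.

Lemma units_onto_dvd (d n : int) :
  (forall x, coprimez x d -> coprimez x n) -> (d %| n)%Z ->
  units_onto n -> units_onto d.
Proof.
move=> cop dn h z /cop /h[w [w1 nw]]; exists w; split=> //; exact: dvdz_trans nw.
Qed.

Lemma units_ontoX (q k j : nat) : (0 < j <= k)%N ->
  units_onto (q ^ k)%N -> units_onto (q ^ j)%N.
Proof.
case/andP=> j0 jk; apply: units_onto_dvd; last by rewrite dvdzE; exact: dvdn_exp2l.
by move=> x; rewrite !coprimezE !absz_nat !coprime_pexpr //; apply: leq_trans jk.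
Qed.

(** * Lifting along the powers of a prime *)

Lemma dvdz_qnorm (q A B n : int) :
  (q %| n)%Z -> (q %| A)%Z -> (q %| qnorm (A, (n * B)%R))%Z.
Proof.
move=> qn qA; rewrite /qnorm /= rpredB ?rpredD //.
- by rewrite expr2 dvdz_mull.
- by rewrite mulrAC dvdz_mull.
- by rewrite expr2 dvdz_mull // dvdz_mull // dvdz_mulr.
Qed.

Lemma unit_fst_ndvd (q : nat) (A B n : int) : prime q -> (q %| n)%Z ->
  qnorm (A, n * B) ^+ 2 = 1 -> ~~ (q %| A)%Z.
Proof.
move=> pq qn e; apply/negP => qA; have : (q %| qnorm (A, (n * B)%R) ^+ 2)%Z.
  by rewrite expr2 dvdz_mull // dvdz_qnorm.
by rewrite e dvdzE /= dvdn1 => /eqP q1; move: pq; rewrite q1.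
Qed.

(** Binomial expansion of [(A + n B al) ^ j] modulo [q ^ 2], the coefficient of [al] being divided
    by [n]. The factor [A ^+ 2] avoids the exponent [j - 2]. *)
Lemma qpow_expansion (q : nat) (A B n : int) j : (q %| n)%Z ->
  exists a b : int, [/\ qpow (A, n * B) j = (a, n * b), ((q%:Z ^+ 2)%R %| (a - A ^+
      j)%R)%Z &
    ((q%:Z ^+ 2)%R %| (A ^+ 2 * b - (j%:Z * A ^+ j.+1 * B +
                              t * n * 'C(j, 2)%:Z * A ^+ j * B ^+ 2))%R)%Z].
Proof.
case/dvdzP => n' nE; elim: j => [|j [a [b [e /dvdzP[c1 h1] /dvdzP[c2 h2]]]]].
  by exists 1, 0; split; [rewrite mulr0 | rewrite subrr dvdz0 | rewrite !(mul0r, mulr0,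
      addr0, subrr) dvdz0].
exists (A * a + m * n ^+ 2 * B * b), (A * b + a * B + t * n * B * b); split.
- by rewrite qpowS e /qmul /=; congr (_, _); ring.
- apply/dvdzP; exists (A * c1 + m * n' ^+ 2 * B * b).
  have -> : a = c1 * q%:Z ^+ 2 + A ^+ j by rewrite -h1; ring.
  by rewrite [A ^+ _.+1]exprS nE; ring.
apply/dvdzP.
exists (A * c2 + A ^+ 2 * B * c1 + t * n * B * c2 + t ^+ 2 * n' ^+ 2 * 'C(j, 2)%:Z * A ^+
    j * B ^+ 3).
have aE : a = c1 * q%:Z ^+ 2 + A ^+ j by rewrite -h1; ring.
have bE : A ^+ 2 * b = c2 * q%:Z ^+ 2 + (j%:Z * A ^+ j.+1 * B +
                              t * n * 'C(j, 2)%:Z * A ^+ j * B ^+ 2).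
  by rewrite -h2; ring.
have -> : A ^+ 2 * (A * b + a * B + t * n * B * b) =
  A * (A ^+ 2 * b) + A ^+ 2 * B * a + t * n * B * (A ^+ 2 * b) by ring.
rewrite bE aE binS bin1 PoszD intS [A ^+ j.+2]exprS [A ^+ j.+1]exprS nE; ring.
Qed.

(** Let [z w = c + n d al]. Multiplying by [(A + n B al) ^ j] makes the coefficient of [al] equal to
    [n (c B j + d A)] modulo [n q], up to a power of [A]. Since [q] divides neither [c] nor [B],
    some [j] kills it. *)
Lemma units_onto_lift (q : nat) (n : int) : prime q -> (q %| n)%Z ->
  units_onto n -> exact_unit q n -> units_onto (n * q).
Proof.
move=> pq qn onto [A [B [AB qB]]] z; rewrite coprimezMr => /andP[zn zq].
have qA := unit_fst_ndvd pq qn AB.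
have [w [w1 /dvdzP[d dE]]] := onto z zn.
pose c := (qmul z w).1; have zwE : qmul z w = (c, n * d).
  by rewrite [LHS]surjective_pairing dE mulrC.
have qc : ~~ (q %| c)%Z.
  apply/negP => qc; move: zq; rewrite coprimez_prime // => /negP; apply.
  have : (q %| qnorm (qmul z w) ^+ 2)%Z.
    by rewrite zwE expr2 dvdz_mull // dvdz_qnorm.
  by rewrite qnormM exprMn w1 mulr1; exact: dvdz_primeX.
have [j jE] : exists j : nat, (q %| c * B * j%:Z + d * A)%Z.
  by apply: linear_congruence => //; rewrite dvdz_primeM // negb_or qc.
have [a [b [pE ha hb]]] := qpow_expansion A B j qn.
exists (qmul w (qpow (A, n * B) j)); split.
  by rewrite qnormM qnormX exprMn w1 -exprM mulnC exprM AB expr1n mulr1.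
rewrite qmulA zwE pE /qmul /=.
have -> : c * (n * b) + n * d * a + t * (n * d) * (n * b) =
          n * (c * b + d * a + t * n * d * b) by ring.
rewrite dvdz_mul //.
have : (q %| A ^+ 2 * (c * b + d * a + t * n * d * b))%Z.
  have q2 x : ((q%:Z ^+ 2)%R %| x)%Z -> (q %| x)%Z.
    by apply: dvdz_trans; rewrite expr2 dvdz_mull.
  have -> : A ^+ 2 * (c * b + d * a + t * n * d * b) =
    c * (A ^+ 2 * b - (j%:Z * A ^+ j.+1 * B + t * n * 'C(j, 2)%:Z * A ^+ j * B ^+ 2)) +
    A ^+ 2 * d * (a - A ^+ j) + A ^+ j.+1 * (c * B * j%:Z + d * A)
    + n * (c * t * 'C(j, 2)%:Z * A ^+ j * B ^+ 2 + t * d * b * A ^+ 2).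
    by rewrite [A ^+ j.+1]exprS; ring.
  apply: rpredD; last exact: dvdz_mulr.
  apply: rpredD; last exact: dvdz_mull.
  by apply: rpredD; apply: dvdz_mull; exact: q2.
by rewrite dvdz_primeM // => /orP[/(dvdz_primeX pq)|//]; rewrite (negPf qA).
Qed.

(** In the [q]-th power the linear term gains exactly one factor [q]; the quadratic one gains two,
    as an odd [q] divides both ['C(q, 2)] and [n]. *)
Lemma exact_unitX (q : nat) (n : int) : prime q -> odd q -> (q %| n)%Z ->
  exact_unit q n -> exact_unit q (n * q).
Proof.
move=> pq oq qn [A [B [AB qB]]]; have qA := unit_fst_ndvd pq qn AB.
have q0 : (q%:Z : int) != 0 by have := prime_gt0 pq; lia.
have [a [b [pE _ /dvdzP[c]]]] := qpow_expansion A B q qn.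
have [k kE] : exists k : int, 'C(q, 2)%:Z = k * q%:Z.
  by exists (q.-1./2)%:Z; rewrite bin2odd //; lia.
case/dvdzP: qn => n' nE; rewrite kE nE.
move=> bE.
have {}bE : A ^+ 2 * b = (c * q%:Z + A ^+ q.+1 * B + t * n' * k * q%:Z * A ^+ q * B ^+ 2)
    * q%:Z.
  by rewrite -[LHS](subrK (q%:Z * A ^+ q.+1 * B + t * (n' * q%:Z) * (k * q%:Z) * A ^+ q *
      B ^+ 2)) bE; ring.
have /dvdzP[B' B'E] : (q %| b)%Z.
  have : (q %| A ^+ 2 * b)%Z by rewrite bE dvdz_mull.
  by rewrite dvdz_primeM // => /orP[/(dvdz_primeX pq)|//]; rewrite (negPf qA).
exists a, B'; split.
  by rewrite -nE -mulrA [q%:Z * _]mulrC -B'E -pE qnormX -exprM mulnC exprM AB expr1n.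
apply/negP => qB'; have : (q %| A ^+ q.+1 * B)%Z.
  have /(mulIf q0) e : A ^+ 2 * B' * q%:Z = (c * q%:Z + A ^+ q.+1 * B + t * n' * k * q%:Z
      * A ^+ q * B ^+ 2) * q%:Z.
    by rewrite -bE B'E mulrA.
  have -> : A ^+ q.+1 * B = A ^+ 2 * B' - q%:Z * (c + t * n' * k * A ^+ q * B ^+ 2).
    by rewrite e; ring.
  by apply: rpredB; [exact: dvdz_mull | exact: dvdz_mulr].
by rewrite dvdz_primeM // (negPf qB) orbF => /(dvdz_primeX pq); rewrite (negPf qA).
Qed.

(** The step from [n] to [n q] is left as a hypothesis because odd primes and 2 are handled by
    different arguments. *)
Lemma units_onto_tower (q : nat) : prime q ->
  (forall n : int, (q %| n)%Z -> exact_unit q n -> exact_unit q (n * q)) ->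
  units_onto q -> exact_unit q q -> forall k, (0 < k)%N -> units_onto (q ^ k)%N.
Proof.
move=> pq step onto ex; suff h k : units_onto (q ^ k.+1)%N /\ exact_unit q (q ^ k.+1)%N.
  by case=> // k _; case: (h k).
elim: k => [|k [IH1 IH2]]; first by rewrite expn1.
have qk : (q %| (q ^ k.+1)%N%:Z)%Z by rewrite dvdzE /= expnS dvdn_mulr.
by rewrite expnSr PoszM; split; [exact: units_onto_lift | exact: step].
Qed.

(** Applied to [1 + q al], surjectivity gives a unit [u + v al] where [q] divides [v] and [v / q] is
    [- u] modulo [q], with [u] prime to [q]. *)
Lemma exact_unit_of_onto_sqr (q : nat) : prime q ->
  units_onto (q ^ 2)%N -> exact_unit q q.
Proof.
move=> pq onto; have q0 : (q%:Z : int) != 0 by have := prime_gt0 pq; lia.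
have qq : (q ^ 2)%N = q%:Z * q%:Z :> int by lia.
have [|[u v] [uv]] := onto (1, q%:Z).
  rewrite qq coprimezMr andbb coprimez_prime // /qnorm /=.
  have -> : 1 ^+ 2 + t * 1 * q%:Z - m * q%:Z ^+ 2 = (t - m * q%:Z) * q%:Z + 1 by ring.
  apply/negP => /dvdzP[s sE]; have : (q %| 1)%Z.
    by apply/dvdzP; exists (s - (t - m * q%:Z)); rewrite mulrBl -sE; ring.
  by rewrite dvdzE /= dvdn1 => /eqP q1; move: pq; rewrite q1.
rewrite qq /qmul /= mul1r => /dvdzP[c e].
have vE : v = q%:Z * (c * q%:Z - u - t * v) by rewrite -[LHS](addrK (q%:Z * u + t * q%:Z
    * v)) addrA e; ring.
move: uv; rewrite vE => uv; exists u, (c * q%:Z - u - t * v); split=> //.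
have qu := unit_fst_ndvd pq (dvdzz q) uv.
apply/negP => h; move/negP: qu; apply.
have -> : u = c * q%:Z - t * v - (c * q%:Z - u - t * v) by ring.
by rewrite rpredB // rpredB // ?dvdz_mull // vE dvdz_mulr.
Qed.

End QuadraticInt.

(** * Small moduli *)

Lemma coprimez_2X (x : int) k : coprimez x (2 ^ k.+1)%N = ~~ (2 %| x)%Z.
Proof. by rewrite -[RHS](@coprimez_prime 2) // !coprimezE !absz_nat coprime_pexpr. Qed.

Lemma int_parity (x : int) : exists y, x = 2 * y \/ x = 2 * y + 1.
Proof. by exists (x %/ 2)%Z; lia. Qed.

Lemma units_onto_2_2 : units_onto 0 2 2%N.
Proof.
move=> [a b]; rewrite (coprimez_2X _ 0) /qnorm /= => ab.
have [a' aE] := int_parity a; have [b' bE] := int_parity b.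
(* The unit [1 + sqrt 2], of norm -1, serves when both coordinates are odd. *)
exists (1, if (2 %| b)%Z then 0 else 1).
by case: ifP => hb; split; rewrite /qmul /qnorm //=; lia.
Qed.

(** If [b] is odd, then [a] is even, and the Pell unit [x + (2 y + 1) sqrt p], whose [x] is even,
    brings the product into the order of index 2. *)
Lemma units_onto_3mod4_2 (p : nat) : prime p -> p = 3 %[mod 4] ->
  units_onto 0 p 2%N.
Proof.
move=> pp p3 [a b]; rewrite (coprimez_2X _ 0) /qnorm /= => ab.
have [x [y xy]] := pell_odd pp p3.
have [k pE] : exists k : int, p%:Z = 4 * k + 3 by exists (p %/ 4)%N; lia.
have [a' aE] := int_parity a; have [b' bE] := int_parity b.
have [x' xE] : exists x', x = 2 * x'.
  by have [x' [xE|xE]] := int_parity x; exists x' => //; move: xy; rewrite xE pE; nia.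
case: bE => bE.
  by exists (1, 0); rewrite /qmul /qnorm /= bE; split; lia.
exists (x, 2 * y + 1); rewrite /qmul /qnorm /= bE; split;
    first by rewrite (_ : _ - _ = 1) ?expr1n // -[RHS]xy; ring.
case: aE => aE; last first.
  move/negP: ab; case; apply/dvdzP; rewrite aE bE pE.
  by exists (2 * a' ^+ 2 + 2 * a' - 8 * k * b' ^+ 2 - 8 * k * b' - 2 * k - 6 * b' ^+ 2 -
      6 * b' - 1); ring.
by apply/dvdzP; rewrite aE xE; exists (a' * (2 * y + 1) + (2 * b' + 1) * x'); ring.
Qed.

(** The norm is [a (a + b)] modulo 2, so odd norm forces [b] even and the unit 1 suffices. *)
Lemma units_onto_1mod8_2 (k : int) : units_onto 1 (2 * k) 2%N.
Proof.
move=> [a b]; rewrite (coprimez_2X _ 0) /qnorm /= => ab.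
have [a' aE] := int_parity a; have [b' bE] := int_parity b.
exists (1, 0); rewrite /qmul /qnorm /=; split; first lia.
case: bE => bE; first by rewrite bE; lia.
move/negP: ab; case; apply/dvdzP; rewrite bE; case: aE => ->.
  by exists (2 * a' ^+ 2 + a' * (2 * b' + 1) - k * (2 * b' + 1) ^+ 2); ring.
by exists (2 * a' ^+ 2 + 2 * a' + 1 + 2 * a' * b' + a' + b' - k * (2 * b' + 1) ^+ 2); ring.
Qed.

Lemma negative_pell_even (k x y : int) : x ^+ 2 - (4 * k + 1) * y ^+ 2 = -1 ->
  exists x' y', x = 2 * x' /\ y = 2 * y' + 1.
Proof.
have [x' xE] := int_parity x; have [y' yE] := int_parity y.
by case: xE => ->; case: yE => -> e; exists x', y'; nia.
Qed.

Lemma units_onto_1mod8_4 (k x y : int) :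
  x ^+ 2 - (4 * (2 * k) + 1) * y ^+ 2 = -1 -> units_onto 1 (2 * k) 4%N.
Proof.
move=> xy [a b]; rewrite (coprimez_2X _ 1) /qnorm /= => ab.
have [x' [y' [xE yE]]] := negative_pell_even xy.
have [a' aE] := int_parity a; have [b' bE] := int_parity b.
have {}aE : a = 2 * a' + 1.
  case: aE => // aE; move/negP: ab; case; apply/dvdzP; rewrite aE.
  by exists (2 * a' ^+ 2 + a' * b - k * b ^+ 2); ring.
have {}bE : b = 2 * b'.
  case: bE => // bE; move/negP: ab; case; apply/dvdzP; rewrite aE bE.
  by exists (2 * a' ^+ 2 + 3 * a' + 1 + 2 * a' * b' + b' - k * (2 * b' + 1) ^+ 2); ring.
have [b'' b'E] := int_parity b'.
case: b'E => b'E.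
  by exists (1, 0); rewrite /qmul /qnorm /= aE bE b'E; split; lia.
(* Here [b] is 2 modulo 4. The unit is [x + y sqrt D] with [D = 8 k + 1], rewritten using
   [sqrt D = 2 al - 1]; its [y] is odd. *)
exists (x - y, 2 * y); rewrite /qmul /qnorm /=; split.
  by rewrite (_ : _ - _ = -1) // -[RHS]xy; ring.
rewrite aE bE b'E xE yE; apply/dvdzP.
exists (2 * a' * y' + a' + y' + 1 + 2 * b'' * x' + x' + 2 * b'' * y' + b'' + y'); ring.
Qed.

Lemma units_onto_5mod8_4 (k x y : int) :
  x ^+ 2 - (4 * k + 1) * y ^+ 2 = -1 ->
  units_onto 1 k 2%N -> units_onto 1 k 4%N.
Proof.
move=> xy onto; have [x' [y' [xE yE]]] := negative_pell_even xy.
apply: (@units_onto_lift 1 k 2 2%N) => //; exists (x - y), y; split; last lia.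
by rewrite /qnorm /= (_ : _ - _ = -1) // -xy; ring.
Qed.

Lemma int_mod3 (x : int) : (3 %| x)%Z \/ exists y, x = 3 * y + 1 \/ x = 3 * y - 1.
Proof.
by have [|h] := boolP (3 %| x)%Z; [left | right; exists ((x + 1) %/ 3)%Z; lia].
Qed.

Lemma sqr_mod3 (x : int) : ~~ (3 %| x)%Z -> exists y, x ^+ 2 = 3 * y + 1.
Proof.
by case: (int_mod3 x) => [->//|[y [->|->]] _]; [exists (3 * y ^+ 2 + 2 * y) | exists (3 *
    y ^+ 2 - 2 * y)]; ring.
Qed.

Lemma sqr_mod3_dvd (x : int) : (3 %| x)%Z -> exists y, x ^+ 2 = 3 * y.
Proof. by case/dvdzP => y ->; exists (3 * y ^+ 2); ring. Qed.

(* Modulo 3 the powers of a unit of norm -1 meet every class of units up to sign. *)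
Lemma negative_pell_mod3 (D x y A B : int) :
  x ^+ 2 - D * y ^+ 2 = -1 -> ~~ (3 %| D)%Z -> ~~ (3 %| A ^+ 2 - D * B ^+ 2)%Z ->
  exists X Y, (X ^+ 2 - D * Y ^+ 2) ^+ 2 = 1 /\ (3 %| A * Y + B * X)%Z.
Proof.
move=> xy D3 AB.
have [hB|hB] := boolP (3 %| B)%Z.
  by exists 1, 0; split; [ring | rewrite mulr0 add0r mulr1].
have [b bE] := sqr_mod3 hB.
have [h|[d [dE|dE]]] := int_mod3 D; first by rewrite h in D3.
  (* When [D] is 1 modulo 3, both [A] and [x] are divisible by 3 and the given unit works. *)
  have hA : (3 %| A)%Z.
    apply/negPn/negP => /sqr_mod3[a aE].
    by move/negP: AB; apply; rewrite aE bE dE; apply/dvdzP;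
        exists (a - 3 * d * b - b - d); ring.
  have hx : (3 %| x)%Z.
    apply/negPn/negP => /sqr_mod3[x' x'E].
    have [/sqr_mod3_dvd|/sqr_mod3] := boolP (3 %| y)%Z; case=> y' y'E; move: xy;
    rewrite x'E y'E dE; lia.
  by exists x, y; split; [rewrite xy | apply: rpredD;
      [apply: dvdz_mulr | apply: dvdz_mull]].
(* When [D] is -1 modulo 3, neither [x] nor [y] is divisible by 3. The square of the unit serves if
   3 divides [A]; otherwise the unit or its conjugate does. *)
have hx : ~~ (3 %| x)%Z.
  apply/negP => /sqr_mod3_dvd[x' x'E].
  by have [/sqr_mod3_dvd|/sqr_mod3] := boolP (3 %| y)%Z; case=> y' y'E; move: xy;
    rewrite x'E y'E dE; lia.
have hy : ~~ (3 %| y)%Z.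
  apply/negP => /sqr_mod3_dvd[y' y'E]; have [x' x'E] := sqr_mod3 hx; move: xy.
  by rewrite x'E y'E dE; lia.
have [hA|hA] := boolP (3 %| A)%Z.
  exists (x ^+ 2 + D * y ^+ 2), (2 * x * y); split.
    have -> : (x ^+ 2 + D * y ^+ 2) ^+ 2 - D * (2 * x * y) ^+ 2 = (x ^+ 2 - D * y ^+ 2)
        ^+ 2 by ring.
    by rewrite xy.
  apply: rpredD; [exact: dvdz_mulr | apply: dvdz_mull].
  have [x' x'E] := sqr_mod3 hx; have [y' y'E] := sqr_mod3 hy.
  by rewrite x'E y'E dE; apply/dvdzP; exists (x' + 3 * d * y' + d - y'); ring.
have : (3 %| (A * y + B * x) * (A * - y + B * x))%Z.
  have [x' x'E] := sqr_mod3 hx; have [y' y'E] := sqr_mod3 hy; have [a aE] := sqr_mod3 hA.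
  have -> : (A * y + B * x) * (A * - y + B * x) = B ^+ 2 * x ^+ 2 - A ^+ 2 * y ^+ 2 by ring.
  by rewrite x'E y'E aE bE; apply/dvdzP; exists (3 * b * x' + b + x' - 3 * a * y' - a -
      y'); ring.
rewrite (@dvdz_primeM 3) // => /orP[] h; first by exists x, y; rewrite xy.
by exists x, (- y); rewrite sqrrN xy.
Qed.

Lemma units_onto_2_3 : units_onto 0 2 3%N.
Proof.
move=> [a b]; rewrite coprimez_prime // /qnorm /= => ab.
have [||X [Y [XY h]]] := @negative_pell_mod3 2 1 1 a b _ isT; first by [].
  by rewrite (_ : _ - _ = a ^+ 2 + 0 * a * b - 2 * b ^+ 2) //; ring.
exists (X, Y); rewrite /qmul /qnorm /=; split; first by rewrite -[RHS]XY; ring.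
by rewrite (_ : _ + _ = a * Y + b * X) //; ring.
Qed.

Lemma units_onto_1mod4_3 (k x y : int) : x ^+ 2 - (4 * k + 1) * y ^+ 2 = -1 ->
  ~~ (3 %| 4 * k + 1)%Z -> units_onto 1 k 3%N.
Proof.
move=> xy k3 [a b]; rewrite coprimez_prime // /qnorm /= => ab.
(* Twice [z] is [(2 a + b) + b sqrt D] with [D = 4 k + 1], and 2 is invertible modulo 3. *)
have [|X [Y [XY h]]] := @negative_pell_mod3 _ x y (2 * a + b) b xy k3.
  rewrite (_ : _ - _ = 4 * (a ^+ 2 + 1 * a * b - k * b ^+ 2)); last by ring.
  by rewrite (@dvdz_primeM 3) // negb_or ab.
exists (X - Y, 2 * Y); rewrite /qmul /qnorm /=; split; first by rewrite -[RHS]XY; ring.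
by rewrite (_ : _ + _ = (2 * a + b) * Y + b * X) //; ring.
Qed.

(** * Towers *)

Section Ramified.
Variables t m D : int.
Hypothesis DE : D = t ^+ 2 + 4 * m.

(* Twice the unit is [x + v s] with [s ^+ 2 = D]; modulo [p ^+ 2] only the first
   four terms of the binomial expansion of [(x + v s) ^+ j] survive. *)
Lemma ramified_expansion (p u v : int) j (x := 2 * u + t * v)
    (a := (qpow t m (u, v) j).1) (b := (qpow t m (u, v) j).2) : (p %| D)%Z ->
  [/\ (p %| (2 ^+ j * (2 * a + t * b) - 2 * x ^+ j)%R)%Z,
      (p %| (x * 2 ^+ j * b - 2 * j%:Z * x ^+ j * v)%R)%Z,
      ((p ^+ 2)%R %| (x ^+ 2 * 2 ^+ j * (2 * a + t * b) -
         2 * x ^+ j * (x ^+ 2 + 'C(j, 2)%:Z * v ^+ 2 * D))%R)%Z &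
      ((p ^+ 2)%R %| (x ^+ 3 * 2 ^+ j * b -
         2 * x ^+ j * (j%:Z * x ^+ 2 * v + 'C(j, 3)%:Z * v ^+ 3 * D))%R)%Z].
Proof.
case/dvdzP => d dE; rewrite {}/a {}/b.
elim: j => [|j]; first by rewrite /= !bin0n /=; split; apply/dvdzP; exists 0;
    rewrite ?expr0; ring.
rewrite qpowS; case: (qpow t m (u, v) j) => a b /= [/dvdzP[c1 h1] /dvdzP[c2 h2] /dvdzP[c3
    h3] /dvdzP[c4 h4]].
have {h1} e1 : 2 ^+ j * (2 * a + t * b) = c1 * p + 2 * x ^+ j by rewrite -h1; ring.
have {h2} e2 : x * 2 ^+ j * b = c2 * p + 2 * j%:Z * x ^+ j * v by rewrite -h2; ring.
have {h3} e3 : x ^+ 2 * 2 ^+ j * (2 * a + t * b) = c3 * p ^+ 2 +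
     2 * x ^+ j * (x ^+ 2 + 'C(j, 2)%:Z * v ^+ 2 * D) by rewrite -h3; ring.
have {h4} e4 : x ^+ 3 * 2 ^+ j * b = c4 * p ^+ 2 +
     2 * x ^+ j * (j%:Z * x ^+ 2 * v + 'C(j, 3)%:Z * v ^+ 3 * D) by rewrite -h4; ring.
set a' := u * a + m * v * b; set b' := u * b + v * a + t * v * b.
have ea : 2 * (2 * a' + t * b') = x * (2 * a + t * b) + D * v * b.
  by rewrite /a' /b' /x DE; ring.
have eb : 2 * b' = x * b + v * (2 * a + t * b) by rewrite /b' /x; ring.
have k2 : 'C(j.+1, 2)%:Z = 'C(j, 2)%:Z + j%:Z by rewrite binS bin1 PoszD.
have k3 : 'C(j.+1, 3)%:Z = 'C(j, 3)%:Z + 'C(j, 2)%:Z by rewrite binS PoszD.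
rewrite k2 k3 intS ![_ ^+ j.+1]exprS; split; apply/dvdzP.
- exists (x * c1 + d * v * 2 ^+ j * b).
  transitivity (2 ^+ j * (2 * (2 * a' + t * b')) - 2 * (x * x ^+ j)); first ring.
  rewrite ea; transitivity (x * (2 ^+ j * (2 * a + t * b)) + 2 ^+ j * D * v * b - 2 * (x
      * x ^+ j)); first ring.
  by rewrite e1 dE; ring.
- exists (x * c2 + x * v * c1).
  transitivity (x * 2 ^+ j * (2 * b') - 2 * (1 + j%:Z) * (x * x ^+ j) * v); first ring.
  rewrite eb; transitivity (x * (x * 2 ^+ j * b) + x * v * (2 ^+ j * (2 * a + t * b)) - 2
      * (1 + j%:Z) * (x * x ^+ j) * v); first ring.
  by rewrite e1 e2; ring.
- exists (x * c3 + d * v * x * c2).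
  transitivity (x ^+ 2 * 2 ^+ j * (2 * (2 * a' + t * b')) - 2 * (x * x ^+ j) * (x ^+ 2 +
      ('C(j, 2)%:Z + j%:Z) * v ^+ 2 * D)); first ring.
  rewrite ea; transitivity (x * (x ^+ 2 * 2 ^+ j * (2 * a + t * b)) + D * v * x * (x * 2
      ^+ j * b)
    - 2 * (x * x ^+ j) * (x ^+ 2 + ('C(j, 2)%:Z + j%:Z) * v ^+ 2 * D)); first ring.
  by rewrite e2 e3 dE; ring.
exists (x * c4 + x * v * c3).
transitivity (x ^+ 3 * 2 ^+ j * (2 * b') - 2 * (x * x ^+ j) * ((1 + j%:Z) * x ^+ 2 * v +
    ('C(j, 3)%:Z + 'C(j, 2)%:Z) * v ^+ 3 * D)); first ring.
rewrite eb; transitivity (x * (x ^+ 3 * 2 ^+ j * b) + x * v * (x ^+ 2 * 2 ^+ j * (2 * a +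
    t * b))
  - 2 * (x * x ^+ j) * ((1 + j%:Z) * x ^+ 2 * v + ('C(j, 3)%:Z + 'C(j, 2)%:Z) * v ^+ 3 *
      D)); first ring.
by rewrite e3 e4; ring.
Qed.

(** Surjectivity yields a unit [(x + v s) / 2] with [x] and [v] prime to [p]. In its [p]-th power
    the cubic term contains ['C(p, 3)] and [D], both divisible by [p] as [p > 3], so the coefficient
    of [al] has exactly one factor [p]. *)
Lemma exact_unit_ramified (p : nat) : prime p -> (3 < p)%N -> (p %| D)%Z ->
  units_onto t m p -> exact_unit t m p p.
Proof.
move=> pp p3 pD onto; have p0 : (p%:Z : int) != 0 by lia.
have p2 k : ~~ (p %| (2 ^+ k)%R)%Z.
  by apply/negP => /(dvdz_primeX pp); rewrite dvdzE /= => /dvdn_leq; lia.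
have p4 : ~~ (p %| 4%R)%Z by exact: (p2 2).
have qnorm4 z : 4 * qnorm t m z = (2 * z.1 + t * z.2) ^+ 2 - D * z.2 ^+ 2.
  by rewrite /qnorm DE; ring.
(* Apply surjectivity to [s + 1], with [s] the square root of [D]. *)
have [|[u v] [uv]] := onto (1 - t, 2).
  rewrite coprimez_prime //; apply/negP => h; have : (p %| (4 * qnorm t m (1 - t,
      2))%R)%Z by rewrite dvdz_mull.
  rewrite qnorm4 /= => h'; have : (p %| 4%R)%Z; last exact/negP.
  rewrite (_ : 4%R = (2 * (1 - t) + t * 2) ^+ 2 - D * 2 ^+ 2 + 4 * D); last by ring.
  by apply: rpredD => //; exact: dvdz_mull.
rewrite /qmul /= => h.
have px : ~~ (p %| (2 * u + t * v)%R)%Z.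
  apply/negP => px; have : (p %| (4 * qnorm t m (u, v) * (4 * qnorm t m (u, v)))%R)%Z.
    apply: dvdz_mull; rewrite qnorm4 /=; apply: rpredB; last exact: dvdz_mulr.
    by rewrite expr2; exact: dvdz_mull.
  have -> : 4 * qnorm t m (u, v) * (4 * qnorm t m (u, v)) = 2 ^+ 4 * qnorm t m (u, v) ^+
      2 by ring.
  by rewrite uv mulr1; exact/negP.
(* The coefficient of [al] in the product with [s + 1] is [x + v]. *)
have pv : ~~ (p %| v)%Z.
  apply/negP => pv; move/negP: px; apply.
  rewrite (_ : 2 * u + t * v = (1 - t) * v + 2 * u + t * 2 * v - v); last by ring.
  exact: rpredB.
have [_ _ _] := @ramified_expansion p u v p pD.
have nE : qnorm t m (qpow t m (u, v) p) ^+ 2 = 1 by rewrite qnormX -exprM mulnC exprM uv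
    expr1n.
move: nE; case: (qpow t m (u, v) p) => a b /= nE /dvdzP[c cE].
have /dvdnP[k kE] : (p %| 'C(p, 3))%N by rewrite prime_dvd_bin.
have /dvdzP[d dE] := pD.
move: px cE; set x := 2 * u + t * v; rewrite kE PoszM dE => px cE.
have {}cE : x ^+ 3 * 2 ^+ p * b = p%:Z * (c * p%:Z + 2 * x ^+ p * (x ^+ 2 * v + k%:Z * v
    ^+ 3 * d * p%:Z)).
  by rewrite -[LHS](subrK (2 * x ^+ p * (p%:Z * x ^+ 2 * v + k%:Z * p%:Z * v ^+ 3 * (d *
      p%:Z)))) cE; ring.
have px3 : ~~ (p %| (x ^+ 3 * 2 ^+ p)%R)%Z.
  by rewrite dvdz_primeM // negb_or p2 andbT; apply: contra px; exact: dvdz_primeX.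
have /dvdzP[B BE] : (p %| b)%Z.
  have : (p %| (x ^+ 3 * 2 ^+ p * b)%R)%Z by rewrite cE dvdz_mulr.
  by rewrite dvdz_primeM // (negPf px3).
exists a, B; split; first by rewrite mulrC -BE.
apply/negP => pB; have : (p %| (2 ^+ 1 * x ^+ (p + 2) * v)%R)%Z.
  have e : x ^+ 3 * 2 ^+ p * B = c * p%:Z + 2 * x ^+ p * (x ^+ 2 * v + k%:Z * v ^+ 3 * d
      * p%:Z).
    by apply: (mulfI p0); rewrite -cE BE; ring.
  have -> : 2 ^+ 1 * x ^+ (p + 2) * v = x ^+ 3 * 2 ^+ p * B - p%:Z * (c + 2 * x ^+ p *
      k%:Z * v ^+ 3 * d).
    by rewrite e exprD; ring.
  by apply: rpredB; [exact: dvdz_mull | exact: dvdz_mulr].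
rewrite !dvdz_primeM // (negPf (p2 1)) (negPf pv) orbF /=.
by move=> /(dvdz_primeX pp) px'; rewrite px' in px.
Qed.

End Ramified.

Lemma units_onto_ramified_tower (t m : int) (p : nat) : prime p -> (3 < p)%N ->
  (p %| t ^+ 2 + 4 * m)%Z -> units_onto t m p ->
  forall k, (0 < k)%N -> units_onto t m (p ^ k)%N.
Proof.
move=> pp p3 pD onto; apply: (units_onto_tower pp) => //.
  by move=> n; apply: exact_unitX => //; case: (even_prime pp) => // p2; rewrite p2 in p3.
exact: (exact_unit_ramified erefl).
Qed.

Lemma units_onto_3_tower : units_onto 0 3 3%N ->
  forall k, (0 < k)%N -> units_onto 0 3 (3 ^ k)%N.
Proof.
move=> onto; apply: units_onto_tower => //; first by move=> n; exact: exact_unitX.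
(* [26 + 15 sqrt 3] is the cube of [2 + sqrt 3]. *)
by exists 26, 5.
Qed.

(** The tower starts from [3 + 2 sqrt 2]. Squaring [A + n B sqrt 2] gives the coefficient [2 n A B]
    with [A B] odd. *)
Lemma units_onto_2_tower : units_onto 0 2 2%N ->
  forall k, (0 < k)%N -> units_onto 0 2 (2 ^ k)%N.
Proof.
move=> onto; apply: units_onto_tower => //; last by exists 3, 1.
move=> n /[dup] n2 /dvdzP[n' nE] [A [B [AB B2]]].
have A2 := @unit_fst_ndvd 0 2 2 A B n isT n2 AB.
exists (A ^+ 2 + 2 * n ^+ 2 * B ^+ 2), (A * B); split.
  have -> : qnorm 0 2 (A ^+ 2 + 2 * n ^+ 2 * B ^+ 2, n * 2%N * (A * B)) = qnorm 0 2 (A, n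
      * B) ^+ 2.
    by rewrite /qnorm /=; ring.
  by rewrite AB expr1n.
by rewrite (@dvdz_primeM 2) // negb_or A2.
Qed.

Lemma units_onto_odd_tower (t m : int) (q : nat) : prime q -> odd q ->
  units_onto t m (q ^ 2)%N -> forall k, (0 < k)%N -> units_onto t m (q ^ k)%N.
Proof.
move=> pq oq onto; apply: (units_onto_tower pq) => //.
- by move=> n; exact: exact_unitX.
- by rewrite -(expn1 q); exact: units_ontoX onto.
- exact: exact_unit_of_onto_sqr.
Qed.

(** * Norm obstructions *)

Section PrimeField.
Variable q : nat.
Hypothesis pq : prime q.

Lemma intr_Fp_eq0 (x : int) : (x%:~R == 0 :> 'F_q) = (q %| x)%Z.
Proof. by rewrite (dvdz_pcharf (pchar_Fp pq)). Qed.

Lemma Fp_intr (x : 'F_q) : exists k : int, x = k%:~R.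
Proof. by exists (val x : nat); rewrite -[RHS]/((val x)%:R) natr_Zp. Qed.

(** Otherwise squaring would be a bijection of a finite field, yet 1 and -1 have the same square. *)
Lemma nonsquare_exists : odd q -> exists x : 'F_q, forall k, x != k ^+ 2.
Proof.
move=> oq; apply: contrapT => /forallNP h.
have sq (x : 'F_q) : exists k, k ^+ 2 == x.
  by apply: contrapT => /forallNP hx; apply: (h x) => k; apply/negP; rewrite eq_sym;
      apply: hx.
pose r x := xchoose (sq x).
have rK : cancel r (fun k => k ^+ 2) by move=> x; apply/eqP; exact: (xchooseP (sq x)).
have /eqP : (1 : 'F_q) = - 1 by apply: (can_inj (canF_sym rK)); rewrite /= sqrrN.
rewrite -subr_eq0 opprK -[1 + 1]/((2 : int)%:~R) intr_Fp_eq0 dvdzE /=.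
by rewrite dvdn_prime2 // => /eqP q2; rewrite q2 in oq.
Qed.

(** If [d] is not a square, it is itself a value. If [d = c ^ 2], the values are the sums of two
    squares, and the least natural number that is not a square in ['F_q] is a square plus 1. *)
Lemma nonsquare_value (d : int) : odd q -> ~~ (q %| d)%Z ->
  exists x y : int, forall k : int, ~~ (q %| (x ^+ 2 + d * y ^+ 2 - k ^+ 2)%R)%Z.
Proof.
move=> oq qd; suff [x [y xy]] : exists x y : 'F_q, forall k, x ^+ 2 + d%:~R * y ^+ 2 != k
    ^+ 2.
  have [a aE] := Fp_intr x; have [b bE] := Fp_intr y; exists a, b => k.
  rewrite -intr_Fp_eq0 rmorphB /= intrD intrM !rmorphXn /= -aE -bE subr_eq0.
  exact: xy.
have [[c cE]|/forallNP nd] := pselect (exists c : 'F_q, d%:~R = c ^+ 2); last first.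
  by exists 0, 1 => k; rewrite expr0n add0r expr1n mulr1; apply/eqP/nd.
have c0 : c != 0.
  by apply: contra qd => /eqP c0; rewrite -intr_Fp_eq0 cE c0 expr0n.
have exn : exists n, ~~ [exists k : 'F_q, n%:R == k ^+ 2].
  have [x xE] := nonsquare_exists oq; exists (val x).
  by rewrite natr_Zp; apply/existsPn.
have [[|n] /existsPn nE nmin] := ex_minnP exn; first by have := nE 0; rewrite expr0n eqxx.
have [/existsP[s /eqP sE]|/nmin] := boolP [exists k : 'F_q, n%:R == k ^+ 2];
    last by rewrite ltnn.
exists s, c^-1 => k; rewrite cE -exprMn divff // expr1n -sE natr1; exact: nE.
Qed.

Lemma sqrt_minus1 : q = 1 %[mod 4] -> exists i : int, (q %| (i ^+ 2 + 1)%R)%Z.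
Proof.
move=> q1; suff [x xE] : exists x : 'F_q, x ^+ 2 + 1 = 0.
  have [i iE] := Fp_intr x; exists i.
  by rewrite -intr_Fp_eq0 rmorphD rmorphXn /= -iE xE.
(* [h] is [(q - 1) / 2]. As [X^h - 1] has at most [h] roots, some [x] satisfies [x ^+ h = -1], and
   [h] is even. *)
pose h := (q %/ 4).*2; have qE : q = h.*2.+1 by rewrite /h; lia.
have h0 : (0 < h)%N by have := prime_gt1 pq; rewrite /h; lia.
have [x x0 xh] : exists2 x : 'F_q, x != 0 & x ^+ h != 1.
  apply: contrapT => hx; have hx' (x : 'F_q) : x != 0 -> x ^+ h = 1.
    by move=> x0; apply: contrapT => /eqP xh; apply: hx; exists x.
  pose rs := enum (predC1 (0 : 'F_q)).
  have := @max_poly_roots _ ('X^h - 1 : {poly 'F_q}) rs.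
  rewrite -size_poly_eq0 size_XnsubC // => /(_ isT).
  have -> : all (root ('X^h - 1)) rs.
    apply/allP => x; rewrite mem_enum => /hx' xE.
    by rewrite /root !hornerE xE subrr.
  rewrite enum_uniq => /(_ isT isT).
  rewrite -cardE cardC1 card_Fp //.
  by rewrite qE /=; lia.
exists (x ^+ (q %/ 4)); rewrite -exprM muln2 -/h; apply/eqP.
have xq : x ^+ h.*2.+1 = x by rewrite -qE -[RHS]expf_card card_Fp.
have : (x ^+ h - 1) * (x ^+ h + 1) == 0.
  rewrite -subr_sqr expr1n -exprM subr_eq0 muln2; apply/eqP/(mulfI x0).
  by rewrite -exprS xq mulr1.
by rewrite mulf_eq0 subr_eq0 (negPf xh).
Qed.

End PrimeField.

(** If [z w] is an integer [c] modulo [q], norms give [N0 * W = c ^ 2] modulo [q]. As [W] is its own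
    inverse and a square, [N0] would be a square. *)
Lemma norm_not_onto (t m : int) (q : nat) (N0 : int) (z : int * int) :
  prime q -> qnorm t m z = N0 -> (forall k : int, ~~ (q %| (N0 - k ^+ 2)%R)%Z) ->
  (forall w, qnorm t m w ^+ 2 = 1 -> exists i, (q %| (qnorm t m w - i ^+ 2)%R)%Z) ->
  ~ units_onto t m q.
Proof.
move=> pq zN nsq usq onto; have q0 := nsq 0; rewrite expr0n subr0 in q0.
have [|w [w1 /dvdzP[d dE]]] := onto z; first by rewrite coprimez_prime // zN.
have [i iE] := usq w w1; have /negP := nsq (i * (qmul t m z w).1); apply.
have e := qnormM t m z w; rewrite zN in e.
set W := qnorm t m w in w1 iE e; set c := (qmul t m z w).1.
rewrite /qnorm dE -/c in e.
have -> : N0 - (i * c) ^+ 2 =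
  (W - i ^+ 2) * c ^+ 2 + q%:Z * (W * (t * c * d - m * d ^+ 2 * q%:Z)).
  by transitivity (N0 * W ^+ 2 - (i * c) ^+ 2); [rewrite w1 mulr1 | rewrite expr2 mulrA
      -e; ring].
by apply: rpredD; [exact: dvdz_mulr | exact: dvdz_mulr].
Qed.

Lemma sqr_unit_int (x : int) : x ^+ 2 = 1 -> x = 1 \/ x = -1.
Proof. by move/eqP; rewrite sqrf_eq1 => /orP[] /eqP; [left|right]. Qed.

(** Modulo 4 the norm is [a ^ 2 + b ^ 2], never -1. *)
Lemma qnorm_3mod4 (k : int) w : qnorm 0 (4 * k + 3) w ^+ 2 = 1 -> qnorm 0 (4 * k + 3) w = 1.
Proof.
case/sqr_unit_int => // e; exfalso; case: w e => a b; rewrite /qnorm /=.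
have [a' aE] := int_parity a; have [b' bE] := int_parity b.
have a2 : a ^+ 2 = 4 * (a' ^+ 2) \/ a ^+ 2 = 4 * (a' ^+ 2 + a') + 1.
  by case: aE => ->; [left | right]; ring.
have b2 : b ^+ 2 = 4 * (b' ^+ 2) \/ b ^+ 2 = 4 * (b' ^+ 2 + b') + 1.
  by case: bE => ->; [left | right]; ring.
rewrite mul0r mul0r; move: (a' ^+ 2) (b' ^+ 2) a2 b2 => A B.
by case=> ->; case=> ->; [move: (k * B) | move: (k * (B + b'))| move: (k * B) | move: (k
    * (B + b'))] => K; lia.
Qed.

Lemma not_units_onto_3mod4 (k : int) (q : nat) : prime q -> odd q ->
  ~~ (q %| 4 * k + 3)%Z -> ~ units_onto 0 (4 * k + 3) q.
Proof.
move=> pq oq qk; have [|x [y xy]] := @nonsquare_value q pq (- (4 * k + 3)) oq;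
    first by rewrite rpredN.
apply: (@norm_not_onto _ _ _ _ (x, y) pq erefl).
  by move=> c; rewrite /qnorm /= (_ : _ - _ = x ^+ 2 + - (4 * k + 3) * y ^+ 2 - c ^+ 2)
      //; ring.
by move=> w /qnorm_3mod4 ->; exists 1; rewrite expr1n subrr dvdz0.
Qed.

Lemma not_units_onto_1mod4 (t m D : int) (q : nat) : prime q -> q = 1 %[mod 4] ->
  (forall x y, exists z, qnorm t m z = x ^+ 2 - D * y ^+ 2) ->
  ~~ (q %| D)%Z -> ~ units_onto t m q.
Proof.
move=> pq q1 hz qD; have oq : odd q by lia.
have [|x [y xy]] := @nonsquare_value q pq (- D) oq; first by rewrite rpredN.
have [z zE] := hz x y; apply: (@norm_not_onto _ _ _ _ z pq zE).
  by move=> c; rewrite (_ : _ - _ = x ^+ 2 + - D * y ^+ 2 - c ^+ 2) //; ring.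
move=> w /sqr_unit_int[] ->; first by exists 1; rewrite expr1n subrr dvdz0.
have [i iE] := sqrt_minus1 pq q1; exists i.
by rewrite (_ : -1 - _ = - (i ^+ 2 + 1)) ?rpredN //; ring.
Qed.

Lemma odd_sqr_mod8 (x : int) : ~~ (2 %| x)%Z -> exists y, x ^+ 2 = 8 * y + 1.
Proof.
case: (int_parity x) => y [->|->] h; first by lia.
by case: (int_parity y) => z [->|->]; [exists (2 * z ^+ 2 + z) | exists (2 * z ^+ 2 + 3 *
    z + 1)]; ring.
Qed.

Lemma not_units_onto_3mod4_4 (k : int) : ~ units_onto 0 (4 * k + 3) 4%N.
Proof.
(* [1 + 2 sqrt D], with [D = 4 k + 3], has norm 5 modulo 8, whereas odd norms from the order of
   index 4 are 1 modulo 8. *)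
move=> onto; have [|w [w1 /dvdzP[d dE]]] := onto (1, 2).
  by rewrite (coprimez_2X _ 1) /qnorm /=; lia.
have e := qnormM 0 (4 * k + 3) (1, 2) w; rewrite (qnorm_3mod4 w1) mulr1 in e.
move: e; rewrite /qnorm dE; set c := (qmul _ _ _ _).1 => /= e.
have [|y yE] := @odd_sqr_mod8 c; last by rewrite yE in e; lia.
apply/negP => /dvdzP[c' cE]; rewrite cE in e; lia.
Qed.

(** Odd norms from the order of index 8 are 1 modulo 8, and 3 is not 1 or -1. *)
Lemma not_units_onto_8 (m : int) (z : int * int) (l : int) :
  qnorm 1 m z = 8 * l + 3 -> ~ units_onto 1 m 8%N.
Proof.
move=> zE onto; have [|w [w1 /dvdzP[d dE]]] := onto z.
  by rewrite (coprimez_2X _ 2) zE; lia.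
have e := qnormM 1 m z w; rewrite zE in e; move: e; rewrite {1}/qnorm dE.
set c := (qmul _ _ _ _).1 => /= e.
have [|y yE] := @odd_sqr_mod8 c; last first.
  by rewrite yE in e; case: (sqr_unit_int w1) => wE; rewrite wE in e; lia.
by apply/negP => /dvdzP[c' cE]; rewrite cE in e; case: (sqr_unit_int w1) => wE;
    rewrite wE in e; lia.
Qed.

(** * The ring of integers in coordinates *)

Lemma prime_nonsquare_rat (p : nat) (r : rat) : prime p -> r ^+ 2 != p%:R.
Proof.
move=> pp; apply/eqP => e; suff : denq r = 0 by move/eqP; rewrite (negPf (denq_neq0 r)).
apply: (prime_nonsquare (x := numq r) pp); apply: (@intr_inj rat).
rewrite [RHS]intrM !rmorphXn /= -[p%:Z%:~R]/(p%:R) -e -[X in X ^+ 2 * _](divq_num_den r)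
    exprMn exprVn divfK //.
by rewrite expf_neq0 // intr_eq0 denq_neq0.
Qed.

Lemma prime_mul_sqr_int (p : nat) (r : rat) (k : int) : prime p ->
  p%:R * r ^+ 2 = k%:~R -> exists l : int, r = l%:~R.
Proof.
move=> pp e; exists (numq r); rewrite -[LHS]divq_num_den.
have e' : p%:Z * numq r ^+ 2 = k * denq r ^+ 2.
  apply: (@intr_inj rat); rewrite [LHS]intrM [RHS]intrM !rmorphXn /= -e -[X in _ * X ^+ 2
      * _](divq_num_den r).
  by rewrite exprMn exprVn -!mulrA mulVf ?mulr1 // expf_neq0 // intr_eq0 denq_neq0.
have : ((denq r ^+ 2)%R %| p%:Z)%Z.
  rewrite -(@Gauss_dvdzl _ _ (numq r ^+ 2)); first by rewrite e' dvdz_mull.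
  by rewrite coprimezXl // coprimezXr // coprimezE coprime_sym coprime_num_den.
rewrite dvdzE abszX /= => dp; suff -> : denq r = 1 by rewrite divr1.
have d0 := denq_gt0 r.
have : (`|denq r| %| p)%N by apply: dvdn_trans dp; rewrite dvdn_mulr.
have [d1 _|d1 /(prime_nt_dvdP pp d1) dE] := eqVneq `|denq r|%N 1%N; first lia.
have := dvdn_leq (prime_gt0 pp) dp; have := prime_gt1 pp; rewrite dE; nia.
Qed.

(** Since [sqrt p] is irrational, the minimal polynomial is [X^2 - 2 a X + (a^2 - p b^2)];
    integrality makes its coefficients integers. *)
Lemma quadratic_Aint (p : nat) (a b : rat) : prime p -> b != 0 ->
  ratr a + ratr b * sqrtC p%:R \in Aint ->
  exists A C : int, 2 * a = A%:~R /\ a ^+ 2 - p%:R * b ^+ 2 = C%:~R.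
Proof.
move=> pp b0; set s := sqrtC _; set x := _ + _ => xA.
have s2 : s ^+ 2 = p%:R by rewrite sqrtCK.
pose q : {poly rat} := 'X^2 - (2 * a) *: 'X + (a ^+ 2 - p%:R * b ^+ 2)%:P.
have qE : q = 'X^2 + (- (2 * a) *: 'X + (a ^+ 2 - p%:R * b ^+ 2)%:P).
  by rewrite scaleNr addrA.
have sq' : (size (- (2 * a) *: 'X + (a ^+ 2 - p%:R * b ^+ 2)%:P : {poly rat})%R <= 2)%N.
  rewrite (leq_trans (size_polyD _ _)) // geq_max (leq_trans (size_scale_leq _ _))
      ?size_polyX //.
  by rewrite (leq_trans (size_polyC_leq1 _)).
have sq : size q = 3%N by rewrite qE size_polyDl size_polyXn.
have mq : q \is monic by rewrite monicE qE lead_coefDl ?size_polyXn ?lead_coefXn.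
have [r [rE mr] rq] := minCpolyP x.
have dq : r %| q.
  rewrite -rq /root /q rmorphD rmorphB /= map_polyXn map_polyZ map_polyX map_polyC /=
      !hornerE.
  rewrite !(rmorphB, rmorphM) /= !rmorph_nat -s2 /x; apply/eqP; ring.
have sr : (1 < size r)%N by have := size_minCpoly x; rewrite rE size_map_poly.
have sr2 : size r != 2%N.
  apply/eqP => sr2; have rX : r = 'X + (r`_0)%:P.
    have r1 : r`_1 = 1 by move: mr; rewrite monicE lead_coefE sr2 => /eqP.
    apply/polyP => -[|[|i]]; rewrite coefD coefX coefC /= ?add0r ?addr0 //.
    by rewrite nth_default // sr2.
  have : root (map_poly ratr r) x by rewrite -rE root_minCpoly.
  rewrite rX /root rmorphD /= map_polyX map_polyC /= !hornerE => /eqP h.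
  have /negP := prime_nonsquare_rat ((- r`_0 - a) / b) pp; apply.
  have sE : s = ratr ((- r`_0 - a) / b).
    rewrite fmorph_div rmorphB rmorphN /=; apply: (canRL (mulfK _)).
      by rewrite fmorph_eq0.
    by rewrite -[LHS](addrK (ratr a + ratr r`_0)) mulrC addrA [_ * s + _]addrC h; ring.
  apply/eqP/(@fmorph_inj _ _ (ratr : rat -> algC)).
  by rewrite rmorphXn /= -sE s2 rmorph_nat.
have rqE : r = q.
  apply/eqP; rewrite -eqp_monic // -dvdp_size_eqp // sq.
  by have := dvdp_leq (monic_neq0 mq) dq; rewrite sq; case: (size r) sr sr2 => [|[|[|[|]]]].
have coef i : (ratr q`_i : algC) \is a Num.int.
  by move: xA => /polyOverP/(_ i); rewrite rE rqE coef_map.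
have coefz i : exists A : int, q`_i = A%:~R.
  by apply/intrP; rewrite -Cint_rat; exact: coef.
have [A AE] := coefz 1; have [C CE] := coefz 0.
exists (- A), C; rewrite rmorphN /= -AE -CE /q !coefE /=; split; ring.
Qed.

(* [alpha d] is a root of [X^2 - al_tr d X - al_cst d]. *)
Definition al_tr (d : nat) : int := if (d == 1 %[mod 4])%N then 1 else 0.
Definition al_cst (d : nat) : int := if (d == 1 %[mod 4])%N then (d %/ 4)%N else d.

Section Coordinates.
Variable p : nat.
Hypothesis pp : prime p.
Local Notation s := (sqrtC p%:R : algC).
Local Notation t := (al_tr p).
Local Notation m := (al_cst p).

Lemma sqrtp_sqr : s ^+ 2 = p%:R. Proof. exact: sqrtCK. Qed.

Lemma alpha_sqrE : alpha p ^+ 2 = t%:~R * alpha p + m%:~R.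
Proof.
rewrite /alpha /al_tr /al_cst; case: eqP => [p1|_].
  have pE : p%:R = (p %/ 4)%:R * 4%:R + 1 :> algC.
    by rewrite {1}(divn_eq p 4) p1 natrD natrM.
  have := sqrtp_sqr; rewrite {2}pE; move: (sqrtC _) => x xE.
  have -> : ((1 + x) / 2%:R) ^+ 2 = (1 + 2%:R * x + x ^+ 2) / 4%:R by field.
  by rewrite xE -[((p %/ 4)%N%:Z)%:~R]/((p %/ 4)%:R); field.
by rewrite sqrtp_sqr mul0r add0r.
Qed.

Lemma sqrt_free (a b : rat) : ratr a + ratr b * s = 0 -> a = 0 /\ b = 0.
Proof.
move=> e; suff b0 : b = 0.
  by split=> //; apply: (@fmorph_inj _ _ (ratr : rat -> algC)); move: e;
      rewrite b0 !rmorph0 mul0r addr0.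
apply/eqP; apply: contraT => b0; have /negP[] := prime_nonsquare_rat (- a / b) pp.
apply/eqP/(@fmorph_inj _ _ (ratr : rat -> algC)).
rewrite rmorphXn rmorph_nat -sqrtp_sqr; congr (_ ^+ 2).
rewrite fmorph_div rmorphN; apply: (canLR (mulfK _)); first by rewrite fmorph_eq0.
by apply/eqP; rewrite eq_sym -subr_eq0 opprK mulrC addrC e.
Qed.

Lemma alpha_rat : exists a b : rat, b != 0 /\ alpha p = ratr a + ratr b * s.
Proof.
rewrite /alpha; case: ifP => _; last first.
  by exists 0, 1; rewrite rmorph0 rmorph1 mul1r add0r.
exists 2^-1, 2^-1; split=> //.
by rewrite fmorphV rmorph_nat mulrDl mul1r mulrC.
Qed.

Lemma alpha_free (a b : int) : a%:~R + b%:~R * alpha p = 0 -> a = 0 /\ b = 0.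
Proof.
have [x [y [y0 ->]]] := alpha_rat => e.
have [|e1 e2] := @sqrt_free (a%:~R + b%:~R * x) (b%:~R * y).
  by rewrite -[RHS]e rmorphD !rmorphM /= !ratr_int; ring.
have b0 : b = 0 by move/eqP: e2; rewrite mulf_eq0 (negPf y0) orbF intr_eq0 => /eqP.
by split=> //; move: e1; rewrite b0 mul0r addr0 => /eqP; rewrite intr_eq0 => /eqP.
Qed.

Lemma alpha_in : alpha p \in sqrt_int p.
Proof.
apply/andP; split; last by have [x [y [_ ->]]] := alpha_rat; apply/sqrt_fieldP; exists x, y.
pose q : {poly algC} := 'X^2 - (t%:~R *: 'X + m%:~R%:P).
have sz : (size (t%:~R *: 'X + m%:~R%:P : {poly algC})%R <= 2)%N.
  rewrite (leq_trans (size_polyD _ _)) // geq_max (leq_trans (size_scale_leq _ _))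
      ?size_polyX //.
  by rewrite (leq_trans (size_polyC_leq1 _)).
apply: (@root_monic_Aint q).
- by rewrite /root /q !hornerE alpha_sqrE subrr.
- by rewrite monicE /q lead_coefDl ?lead_coefXn ?size_polyXn ?size_polyN.
apply/polyOverP => i; rewrite !coefE; apply/intrP.
by exists ((i == 2%N)%:R - (t * (i == 1%N)%:R + if i == 0%N then m else 0));
  rewrite !(rmorphB, rmorphD, rmorphM) /= !rmorph_nat; case: ifP.
Qed.

Definition al : int_ring p := Sub (alpha p) alpha_in.

Definition of_coord (z : int * int) : int_ring p := z.1%:~R + z.2%:~R * al.

Lemma val_of_coord z : val (of_coord z) = (z.1%:~R : algC) + (z.2%:~R : algC) * alpha p.
Proof. by rewrite rmorphD rmorphM !rmorph_int. Qed.

Lemma of_coord_inj : injective of_coord.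
Proof.
move=> [a b] [c d] /(congr1 val); rewrite !val_of_coord /= => e.
have [|e1 e2] := @alpha_free (a - c) (b - d).
  by rewrite !rmorphB /= mulrBl addrACA -opprD e subrr.
by congr (_, _); apply/eqP; rewrite -subr_eq0 ?e1 ?e2.
Qed.

Lemma of_coordM z w : of_coord z * of_coord w = of_coord (qmul t m z w).
Proof.
case: z w => [a b] [c d]; apply/val_inj.
transitivity (val (of_coord (a, b)) * val (of_coord (c, d))); first exact: rmorphM.
rewrite !val_of_coord /qmul /=.
transitivity (a%:~R * c%:~R + (a%:~R * d%:~R + b%:~R * c%:~R) * alpha p
  + b%:~R * d%:~R * alpha p ^+ 2); first by ring.
by rewrite alpha_sqrE !intrD !intrM /=; ring.
Qed.

Lemma of_coordB z w : of_coord z - of_coord w = of_coord (z.1 - w.1, z.2 - w.2).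
Proof. by rewrite /of_coord /= !rmorphB /= mulrBl; ring. Qed.

Lemma of_coord1 : of_coord (1, 0) = 1.
Proof. by rewrite /of_coord /= mul0r addr0. Qed.

(** An irrational integer is [(A + B s) / 2] with [A ^+ 2 - p * B ^+ 2] divisible by 4. So [A] and
    [B] have equal parity if [p] is 1 modulo 4, and are both even otherwise. *)
Lemma of_coord_surj (x : int_ring p) : exists z, x = of_coord z.
Proof.
suff [a [b e]] : exists a b : int, val x = a%:~R + b%:~R * alpha p.
  by exists (a, b); apply/val_inj; rewrite val_of_coord.
case: x => x /= /andP[xA /sqrt_fieldP[a [b xE]]].
have [b0|b0] := eqVneq b 0.
  have /intrP[k kE] : x \is a Num.int.
    apply: Cint_rat_Aint => //; rewrite xE b0 rmorph0 mul0r addr0; exact: Crat_rat.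
  by exists k, 0; rewrite kE mul0r addr0.
rewrite xE in xA; have [A [C [AE CE]]] := quadratic_Aint pp b0 xA.
have [|B BE] := @prime_mul_sqr_int p (2 * b) (A ^+ 2 - 4 * C) pp.
  by rewrite rmorphB /= [(4 * C)%:~R]intrM rmorphXn /= -AE -CE; ring.
have e : A ^+ 2 - p%:Z * B ^+ 2 = 4 * C.
  apply: (@intr_inj rat); rewrite rmorphB /= [(p%:Z * _)%:~R]intrM [(4 * C)%:~R]intrM
      !rmorphXn /= -AE -BE -CE.
  by rewrite -[p%:Z%:~R]/(p%:R); ring.
have xE' : x = (A%:~R + B%:~R * s) / 2.
  have aE : a = A%:~R / 2 by rewrite -AE mulrC mulKf.
  have bE : b = B%:~R / 2 by rewrite -BE mulrC mulKf.
  by rewrite xE aE bE !fmorph_div /= !rmorph_int !rmorph_nat; field.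
have [a' aE] := int_parity A; have [b' bE] := int_parity B.
rewrite /alpha; case: eqP => p1.
  exists (a' - b'), B; rewrite xE'; suff -> : A%:~R = 2 * (a' - b')%:~R + B%:~R :> algC
      by field.
  rewrite -[2]/(2%:~R) -rmorphM -rmorphD /=; congr (_%:~R).
  have [k pE] : exists k : int, p%:Z = 4 * k + 1 by exists (p %/ 4)%N; lia.
  by move: e; rewrite pE; case: aE => ->; case: bE => ->; lia.
exists a', b'; rewrite xE'.
suff [-> ->] : A = 2 * a' /\ B = 2 * b' by rewrite !rmorphM /=; field.
have [k [r [pE r3]]] : exists k r : int, p%:Z = 4 * k + r /\ (r = 2 \/ r = 3).
  have [p2|op] := even_prime pp; first by exists 0, 2; rewrite p2; split; [lia | left].
  by exists (p %/ 4)%N, 3; split; [lia | right].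
move: e; rewrite pE.
by case: aE => ->; case: bE => ->; case: r3 => -> e; split; lia.
Qed.

End Coordinates.

(** * Locally associated orders *)

Section Link.
Local Open Scope quotient_scope.
Variables (p n : nat).
Hypotheses (pp : prime p) (n0 : (0 < n)%N).
Local Notation t := (al_tr p).
Local Notation m := (al_cst p).
Local Notation B := (quad_order p n).
Local Notation E := (of_coord p).
Local Notation red := (\pi_(cond_quot B)).

Lemma quad_orderP z : (E z \in B) = (n %| z.2)%Z.
Proof.
apply/Cint_span2P/dvdzP => [[a [b]]|[q zE]].
  rewrite val_of_coord => e.
  have [|e1 e2] := @alpha_free p pp (z.1 - a) (z.2 - b * n%:Z).
    rewrite !rmorphB /= intrM mulrBl addrACA -opprD.
    by rewrite -[(n%:Z)%:~R]/(n%:R) -mulrA -e subrr.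
  by exists b; apply/eqP; rewrite -subr_eq0 e2.
by exists z.1, q; rewrite val_of_coord zE intrM -mulrA.
Qed.

(** Multiplying by [al] alone already forces [n] to divide both coordinates. *)
Lemma quad_conductorP z :
  (E z \in conductor B) = (n %| z.1)%Z && (n %| z.2)%Z.
Proof.
apply/conductorP/andP => [[]|[z1 z2]]; rewrite quad_orderP.
  move=> z2 /(_ (E (0, 1))); rewrite of_coordM quad_orderP /qmul /= => h; split=> //.
  rewrite (_ : z.1 = (z.1 * 1 + z.2 * 0 + t * z.2 * 1) - t * z.2); last by ring.
  by apply: rpredB => //; exact: dvdz_mull.
split=> // y; have [w ->] := of_coord_surj pp y; rewrite of_coordM quad_orderP /qmul /=.
apply: rpredD; first by apply: rpredD; exact: dvdz_mulr.
by rewrite mulrAC; apply: dvdz_mull.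
Qed.

Lemma red_eqP z w :
  reflect (red (E z) = red (E w)) ((n %| z.1 - w.1)%Z && (n %| z.2 - w.2)%Z).
Proof.
rewrite -[X in reflect _ X](quad_conductorP (z.1 - w.1, z.2 - w.2)) -of_coordB.
exact: pi_condP.
Qed.

Lemma cond_quot_finite : exists s : seq (cond_quot B), forall x, x \in s.
Proof.
pose r := [seq k%:Z | k <- iota 0 n].
exists [seq red (E z) | z <- allpairs pair r r] => x.
have [z zE] := of_coord_surj pp (repr x).
have rP (a : int) : (a %% n)%Z \in r.
  have h1 : (0 <= (a %% n)%Z) by rewrite modz_ge0 //; lia.
  have h2 : (a %% n)%Z < n by rewrite ltz_pmod //; lia.
  apply/mapP; exists `|(a %% n)%Z|%N; last by rewrite gez0_abs.
  by rewrite mem_iota; lia.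
apply/mapP; exists ((z.1 %% n)%Z, (z.2 %% n)%Z).
  by apply/allpairsP; exists ((z.1 %% n)%Z, (z.2 %% n)%Z); split; rewrite ?rP.
rewrite -[LHS]reprK zE; apply/red_eqP => /=.
by apply/andP; split; rewrite -eqz_mod_dvd modz_mod.
Qed.

Definition qconj (z : int * int) : int * int := (z.1 + t * z.2, - z.2).

(** The norm times the conjugate: the inverse when the norm is 1 or -1. *)
Definition qinv (z : int * int) : int * int :=
  (qnorm t m z * (z.1 + t * z.2), - (qnorm t m z * z.2)).

Lemma of_coordV z : qnorm t m z ^+ 2 = 1 -> E z * E (qinv z) = 1.
Proof.
move=> z1; rewrite of_coordM -(of_coord1 p); congr (E (_, _)).
  by rewrite -[RHS]z1 /qinv /= /qnorm; ring.
by rewrite /=; ring.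
Qed.

Lemma qnorm_unit z w : E z * E w = 1 -> qnorm t m z * qnorm t m w = 1.
Proof.
rewrite of_coordM -(of_coord1 p) => /(of_coord_inj pp) e.
by rewrite -qnormM e /qnorm /=; ring.
Qed.

Lemma qnorm_congr (a b : int) : (n %| b)%Z ->
  coprimez (qnorm t m (a, b)) n = coprimez a n.
Proof.
case/dvdzP => c ->; rewrite -[RHS](@coprimez_pexpl 2) // /qnorm /=.
rewrite (_ : _ - _ = (t * a * c - m * c ^+ 2 * n%:Z) * n%:Z + a ^+ 2); last by ring.
by rewrite /coprimez gcdzC gcdzMDl gcdzC.
Qed.

Lemma locally_associatedP : locally_associated B <-> units_onto t m n.
Proof.
split=> [LA z /coprimezP[[u v] /= uv]|onto].
  have [s sE] := cond_quot_finite.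
  have surj := locally_associated_finite_surj sE LA.
  (* As [u] inverts the norm modulo [n], [u] times the conjugate inverts [z]. *)
  have XP : (red (E z), red (E (qmul t m (u, 0) (qconj z)))).1 *
            (red (E z), red (E (qmul t m (u, 0) (qconj z)))).2 == 1.
    rewrite /= -pi_condM of_coordM -pi_cond1 -(of_coord1 p); apply/eqP/red_eqP.
    rewrite (_ : qmul _ _ z _ = (u * qnorm t m z, 0)); last first.
      by rewrite /qmul /qconj /qnorm /=; congr (_, _); ring.
    by rewrite subrr dvdz0 andbT /= -uv opprD addNKr rpredN dvdz_mull.
  have [x xE] := surj (\pi_(unit_quot (cond_subquot B)) (UnitGroup XP)).
  move: xE; rewrite -[x]reprK natural_mapE; move: (repr x) => {x} [[y y'] /= yy'] /esym/eqP.
  rewrite unit_quotE => /andP[/= h _]; move: yy' h => /=.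
  have [w wE] := of_coord_surj pp y'; have [w' w'E] := of_coord_surj pp y.
  rewrite wE w'E => /eqP/qnorm_unit ww'; rewrite -pi_condM of_coordM => /cond_subquotP.
  rewrite quad_orderP => h; exists w; split=> //; move: ww'.
  by case: (qnorm t m w') (qnorm t m w) => [[|[|a]]|[|a]] [[|[|b]]|[|b]] //; lia.
apply: locally_associated_surj => X; rewrite -[X]reprK; move: (repr X) => {X} [[x y] /= xy].
have [z zE] := of_coord_surj pp (repr x); have [z' z'E] := of_coord_surj pp (repr y).
have xE : x = red (E z) by rewrite -zE reprK.
have yE : y = red (E z') by rewrite -z'E reprK.
have /andP[/= h1 h2] : (n %| (qmul t m z z').1 - 1)%Z && (n %| (qmul t m z z').2 - 0)%Z.
  apply/(red_eqP _ (1, 0)); rewrite -of_coordM of_coord1 pi_condM pi_cond1 -xE -yE.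
  exact/eqP.
rewrite subr0 in h2.
have zz' : coprimez (qnorm t m (qmul t m z z')) n.
  rewrite [qmul _ _ _ _]surjective_pairing qnorm_congr //.
  case/dvdzP: h1 => c h1; rewrite -[_.1](subrK 1) h1.
  by rewrite /coprimez gcdzC gcdzMDl gcdzC gcd1z.
have [w [w1 wn]] : exists w, qnorm t m w ^+ 2 = 1 /\ (n %| (qmul t m z w).2)%Z.
  by apply: onto; move: zz'; rewrite qnormM coprimezMl => /andP[].
(* The preimage is the class of the inverse of [w], since [z w] lies in the order. *)
have UP : (E (qinv w), E w).1 * (E (qinv w), E w).2 == 1.
  by rewrite /= mulrC of_coordV.
exists (\pi_(unit_quot B) (UnitGroup UP)); rewrite natural_mapE; apply/esym/eqP.
rewrite unit_quotE; apply/andP; split=> /=.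
  by rewrite xE -pi_condM of_coordM; apply/cond_subquotP; rewrite quad_orderP.
rewrite yE -pi_condM of_coordM; apply/cond_subquotP; rewrite quad_orderP.
(* The product [k l = z z'] is 1 modulo [n], and [k] is modulo [n] an integer prime to [n]; hence
   [l] is an integer modulo [n]. *)
set k := qmul t m z w in wn; set l := qmul t m z' (qinv w).
have kl : qmul t m k l = qmul t m z z'.
  apply: (@of_coord_inj p pp); rewrite -!of_coordM mulrACA of_coordV // mulr1 //.
have kn : coprimez k.1 n.
  move: zz'; rewrite -kl qnormM coprimezMl => /andP[+ _].
  by rewrite [k]surjective_pairing qnorm_congr.
rewrite -(@Gauss_dvdzr n k.1); last by rewrite /coprimez gcdzC.
have e : (qmul t m k l).2 = k.1 * l.2 + k.2 * (l.1 + t * l.2) by rewrite /qmul /=; ring.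
rewrite (_ : k.1 * l.2 = (qmul t m k l).2 - k.2 * (l.1 + t * l.2)); last by rewrite e; ring.
by apply: rpredB; [rewrite kl | exact: dvdz_mulr].
Qed.

End Link.

(** * The nine assertions, by residue of p *)

Lemma al_1mod4 (p : nat) : p = 1 %[mod 4] ->
  exists k : nat, [/\ al_tr p = 1, al_cst p = k & p%:Z = 4 * k%:Z + 1].
Proof.
move=> p1; exists (p %/ 4)%N; rewrite /al_tr /al_cst p1 eqxx; split=> //.
by have := divn_eq p 4; lia.
Qed.

Lemma al_not1mod4 (p : nat) : p <> 1 %[mod 4] -> al_tr p = 0 /\ al_cst p = p.
Proof. by move=> /eqP/negPf p1; rewrite /al_tr /al_cst p1. Qed.

Lemma al_disc (p : nat) : exists c : int, al_tr p ^+ 2 + 4 * al_cst p = c * p%:Z.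
Proof.
have [p1|p1] := eqVneq (p %% 4)%N (1 %% 4)%N.
  by have [k [-> -> ->]] := al_1mod4 p1; exists 1; ring.
by have [-> ->] := al_not1mod4 (elimN eqP p1); exists 4; ring.
Qed.

Section LocallyAssociatedOrders.
Variable p : nat.
Hypothesis pp : prime p.
Local Notation LA n := (locally_associated (quad_order p n)).

Lemma locally_associatedXP (q k : nat) : prime q ->
  LA (q ^ k)%N <-> units_onto (al_tr p) (al_cst p) (q ^ k)%N.
Proof.
by move=> pq; apply: locally_associatedP; rewrite // expn_gt0 prime_gt0.
Qed.

Lemma locally_associated_2 : p <> 5 %[mod 8] -> LA 2.
Proof.
move=> p5; apply/locally_associatedP => //; have [p2|op] := even_prime pp.
  by rewrite p2; exact: units_onto_2_2.
have [p1|p1] := eqVneq (p %% 4)%N (1 %% 4)%N.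
  have [k [-> -> pE]] := al_1mod4 p1.
  have -> : k%:Z = 2 * (p %/ 8)%N%:Z by lia.
  exact: units_onto_1mod8_2.
have [-> ->] := al_not1mod4 (elimN eqP p1); apply: units_onto_3mod4_2 => //; lia.
Qed.

Lemma locally_associated_4 : p = 1 %[mod 8] -> LA 4.
Proof.
move=> p1; apply/locally_associatedP => //; have p14 : p = 1 %[mod 4] by lia.
have [x [y]] := negative_pell pp p14; have [k [-> -> pE]] := al_1mod4 p14.
rewrite pE; have -> : k%:Z = 2 * (p %/ 8)%N%:Z by lia.
exact: units_onto_1mod8_4.
Qed.

Lemma locally_associated_3 : p <> 3 %[mod 4] -> LA 3.
Proof.
move=> p3; apply/locally_associatedP => //; have [p2|op] := even_prime pp.
  by rewrite p2; exact: units_onto_2_3.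
have p1 : p = 1 %[mod 4] by lia.
have [x [y]] := negative_pell pp p1; have [k [-> -> pE]] := al_1mod4 p1.
rewrite pE => /units_onto_1mod4_3; apply; rewrite -pE dvdzE /= dvdn_prime2 //.
by apply/eqP => p3'; apply: p3; rewrite -p3'.
Qed.

Lemma locally_associated_ramified :
  (forall k : nat, (1 <= k)%N -> LA (p ^ k)%N) <-> LA p.
Proof.
split=> [|/(locally_associatedP pp (prime_gt0 pp)) onto k k1].
  by move/(_ 1%N erefl); rewrite expn1.
apply/(locally_associatedXP _ pp); move: k k1.
(* The ramified argument requires [p > 3]; 2 and 3 use explicit units. *)
have [p3|p3] := leqP p 3.
  have [p2|p3'] : p = 2%N \/ p = 3%N by have := prime_gt1 pp; lia.
    by move: onto; rewrite p2; exact: units_onto_2_tower.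
  by move: onto; rewrite p3'; exact: units_onto_3_tower.
apply: units_onto_ramified_tower => //.
by have [c ->] := al_disc p; exact: dvdz_mull.
Qed.

Lemma locally_associated_4_2 : p = 5 %[mod 8] -> LA 4 <-> LA 2.
Proof.
move=> p5; have p1 : p = 1 %[mod 4] by lia.
apply: (iff_trans (locally_associatedP pp (isT : 0 < 4)%N)).
apply: (iff_trans _ (iff_sym (locally_associatedP pp (isT : 0 < 2)%N))); split.
  exact: (@units_ontoX _ _ 2 2 1).
have [x [y]] := negative_pell pp p1; have [k [-> -> ->]] := al_1mod4 p1.
exact: units_onto_5mod8_4.
Qed.

Lemma locally_associated_odd_tower (q : nat) : prime q -> odd q ->
  (forall k : nat, (1 <= k)%N -> LA (q ^ k)%N) <-> LA (q ^ 2)%N.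
Proof.
move=> pq oq; split=> [|/(locally_associatedXP _ pq) onto k k1]; first by apply.
by apply/(locally_associatedXP _ pq); exact: units_onto_odd_tower onto k k1.
Qed.

Lemma not_locally_associated_odd (q k : nat) :
  prime q -> odd q -> q <> p -> (1 <= k)%N ->
  p = 3 %[mod 4] \/ q = 1 %[mod 4] -> ~ LA (q ^ k)%N.
Proof.
move=> pq oq qp k1 pq3 /(locally_associatedXP _ pq) /(@units_ontoX _ _ q k 1) onto.
have {onto} := onto k1; rewrite expn1.
have qp' : ~~ (q %| p%:Z)%Z by rewrite dvdzE /= dvdn_prime2 //; apply/eqP.
have [p3|p3] := eqVneq (p %% 4)%N (3 %% 4)%N.
  have [|-> ->] := @al_not1mod4 p; first by lia.
  have pE : p%:Z = 4 * (p %/ 4)%N%:Z + 3 by have := divn_eq p 4; lia.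
  by rewrite pE; apply: not_units_onto_3mod4; rewrite // -pE.
have q1 : q = 1 %[mod 4] by case: pq3 => // p3'; rewrite p3' eqxx in p3.
apply: (@not_units_onto_1mod4 _ _ p) => // x y.
have [p1|p1] := eqVneq (p %% 4)%N (1 %% 4)%N.
  by have [r [-> -> ->]] := al_1mod4 p1; exists (x - y, 2 * y); rewrite /qnorm /=; ring.
by have [-> ->] := al_not1mod4 (elimN eqP p1); exists (x, y); rewrite /qnorm /=; ring.
Qed.

Lemma not_locally_associated_4 : p = 3 %[mod 4] -> ~ LA 4.
Proof.
move=> p3 /(locally_associatedP pp (isT : 0 < 4)%N).
have [|-> ->] := @al_not1mod4 p; first by lia.
have -> : p%:Z = 4 * (p %/ 4)%N%:Z + 3 by have := divn_eq p 4; lia.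
exact: not_units_onto_3mod4_4.
Qed.

Lemma not_locally_associated_8 : odd p -> ~ LA 8.
Proof.
move=> op /(locally_associatedP pp (isT : 0 < 8)%N).
have [p1|p1] := eqVneq (p %% 4)%N (1 %% 4)%N; last first.
  move=> /(@units_ontoX _ _ 2 3 2 isT) /(locally_associatedP pp (isT : 0 < 4)%N).
  by apply: not_locally_associated_4; lia.
have [k [-> -> pE]] := al_1mod4 p1.
(* [1 + 2 al] and [-1 + 2 al] have norms [3 - 4 k] and [-1 - 4 k]; the parity of [k] decides which
   is 3 modulo 8. *)
have [k' kE] := int_parity k; case: kE => kE; rewrite kE.
  by apply: (@not_units_onto_8 _ (1, 2) (- k')); rewrite /qnorm /=; ring.
by apply: (@not_units_onto_8 _ (-1, 2) (- k' - 1)); rewrite /qnorm /=; ring.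
Qed.

End LocallyAssociatedOrders.

Close Scope ring_scope.

Theorem theorem3p1 (p : nat) (hp : prime p) :
  let LA (n : nat) : Prop := locally_associated (quad_order p n) in
  (p <> 5 %[mod 8] -> LA 2) /\
  (p = 1 %[mod 8] -> LA 4) /\
  (p <> 3 %[mod 4] -> LA 3) /\
  ((forall k : nat, 1 <= k -> LA (p ^ k)) <-> LA p) /\
  (p = 5 %[mod 8] -> (LA 4 <-> LA 2)) /\
  (forall q : nat, prime q -> odd q -> q <> p ->
     ((forall k : nat, 1 <= k -> LA (q ^ k)) <-> LA (q ^ 2))) /\
  (forall q k : nat, prime q -> odd q -> q <> p -> 1 <= k ->
     p = 3 %[mod 4] \/ q = 1 %[mod 4] -> ~ LA (q ^ k)) /\
  (p = 3 %[mod 4] -> ~ LA 4) /\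
  (odd p -> ~ LA 8).
Proof.
split; first exact: locally_associated_2.
split; first exact: locally_associated_4.
split; first exact: locally_associated_3.
split; first exact: locally_associated_ramified.
split; first exact: locally_associated_4_2.
split; first by move=> q pq oq _; exact: locally_associated_odd_tower.
split; first exact: not_locally_associated_odd.
split; first exact: not_locally_associated_4.
exact: not_locally_associated_8.
Qed.
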